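(* Let $p\colon V\to M$ be a complex vector bundle of complex rank $r$. If a diffeomorphism $\varphi\colon M\to M$ can be lifted to an $\mathbb{R}$-linear automorphism $\Phi\colon V\to V$, then there exists a fibre bundle $q\colon E\to M$ with standard fibre $Gl(r,\mathbb{C})$ whose global sections can be identified to the $\mathbb{C}$-linear automorphisms $\Phi'\colon V\to V$ such that $h_V(\Phi')=\varphi$.
   Context: All manifolds are connected, second countable, $C^\infty$, without boundary and finite-dimensional; all maps and bundles are $C^\infty$. An $\mathbb{R}$-linear (resp. $\mathbb{C}$-linear) automorphism of $V$ is a diffeomorphism $\Phi\colon V\to V$ permuting the fibres of $p$ such that, for every $x\in M$, the induced map $V_x\to V_{x'}$ on the fibre $V_x=p^{-1}(x)$ is $\mathbb{R}$-linear (resp. $\mathbb{C}$-linear); it need not cover the identity of $M$. $h_V(\Phi)$ denotes the diffeomorphism $x\mapsto x'$ of $M$ induced by $\Phi$, and $\varphi$ can be lifted to $\Phi$ if $h_V(\Phi)=\varphi$, i.e. $p\circ\Phi=\varphi\circ p$. *)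

(* Defs.v *)
(* MathComp / MathComp-Analysis world; the reals are an arbitrary realType R,
   the complex numbers are R[i]. *)
From HB Require Import structures.
From mathcomp Require Import all_boot all_order all_algebra.
From mathcomp Require Import complex.
From mathcomp Require Import all_classical all_reals all_analysis.

Set Implicit Arguments.
Unset Strict Implicit.
Unset Printing Implicit Defensive.

Import Order.TTheory GRing.Theory Num.Theory numFieldNormedType.Exports.
Local Open Scope classical_set_scope.
Local Open Scope ring_scope.
Local Open Scope complex_scope.

(** * Smooth maps between open subsets of Euclidean spaces *)

(* [f] is a total function of which only the values on the open set [U] matter.
   C^(k+1) means: Frechet differentiable at each point of [U], with C^k
   directional derivatives; in finite dimension this says that
   x |-> 'd f x is C^k. *)
Fixpoint Ck_on (R : realType) (m n k : nat) (U : set 'rV[R]_m)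
    (f : 'rV[R]_m -> 'rV[R]_n) {struct k} : Prop :=
  match k with
  | 0%N => forall x, U x -> {for x, continuous f}
  | k'.+1 => (forall x, U x -> differentiable f x) /\
             (forall v : 'rV[R]_m, Ck_on k' U (fun x => 'D_v f x))
  end.

Definition Cinf_on (R : realType) (m n : nat) (U : set 'rV[R]_m)
    (f : 'rV[R]_m -> 'rV[R]_n) : Prop := forall k, Ck_on k U f.

(** * Manifolds *)

(* The maps are total; [chart_fun] is meaningful on [chart_dom] only, and
   [chart_inv] on [chart_img] only. *)
Record chart (R : realType) (T : Type) (n : nat) := Chart {
  chart_dom : set T;
  chart_fun : T -> 'rV[R]_n;
  chart_inv : 'rV[R]_n -> T }.

Definition chart_img (R : realType) (T : Type) (n : nat) (c : chart R T n) :
  set 'rV[R]_n := chart_fun c @` chart_dom c.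

Definition is_chart (R : realType) (T : topologicalType) (n : nat)
    (c : chart R T n) : Prop :=
  [/\ open (chart_dom c),
      open (chart_img c),
      forall x, chart_dom c x -> chart_inv c (chart_fun c x) = x,
      forall x, chart_dom c x -> {for x, continuous (chart_fun c)} &
      forall y, chart_img c y -> {for y, continuous (chart_inv c)}].

(* The data only (topological space, dimension, set of charts); the axioms are
   in [is_manifold]. *)
Record space_with_charts (R : realType) := SpaceWithCharts {
  carrier :> topologicalType;
  dimension : nat;
  atlas : set (chart R carrier dimension) }.

Definition smooth_on (R : realType) (X Y : space_with_charts R) (A : set X)
    (f : X -> Y) : Prop :=
  (forall x, A x -> {for x, continuous f}) /\
  forall c d, atlas c -> atlas d ->
    Cinf_on (chart_fun c @` (A `&` chart_dom c `&` f @^-1` chart_dom d))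
            (fun y => chart_fun d (f (chart_inv c y))).

Definition smooth (R : realType) (X Y : space_with_charts R) (f : X -> Y) :=
  smooth_on [set: X] f.

Definition is_manifold (R : realType) (X : space_with_charts R) : Prop :=
  [/\ hausdorff_space X,
      @second_countable X,
      connected [set: X],
      (forall c : chart R X (dimension X), atlas c -> is_chart c) /\
      (forall x : X, exists2 c, atlas c & chart_dom c x) &
      forall c d : chart R X (dimension X), atlas c -> atlas d ->
        Cinf_on (chart_fun c @` (chart_dom c `&` chart_dom d))
                (fun y => chart_fun d (chart_inv c y))].

Record manifold (R : realType) := Manifold {
  manifold_space :> space_with_charts R;
  manifoldP : is_manifold manifold_space }.

(* [f] restricts to a diffeomorphism of the open set [A] onto the open set [B],
   with inverse [g]. *)
Definition diffeo_on (R : realType) (X Y : space_with_charts R)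
    (A : set X) (B : set Y) (f : X -> Y) (g : Y -> X) : Prop :=
  [/\ forall x, A x -> B (f x) /\ g (f x) = x,
      forall y, B y -> A (g y) /\ f (g y) = y,
      smooth_on A f & smooth_on B g].

Definition diffeomorphism (R : realType) (X Y : space_with_charts R)
    (f : X -> Y) : Prop :=
  exists g : Y -> X, diffeo_on [set: X] [set: Y] f g.

Definition prod_chart (R : realType) (S T : Type) (m n : nat)
    (c : chart R S m) (d : chart R T n) : chart R (S * T)%type (m + n) :=
  Chart (chart_dom c `*` chart_dom d)
        (fun z => row_mx (chart_fun c z.1) (chart_fun d z.2))
        (fun w => (chart_inv c (lsubmx w), chart_inv d (rsubmx w))).

Definition prod_space (R : realType) (X Y : space_with_charts R) :
    space_with_charts R :=
  @SpaceWithCharts R (X * Y)%type (dimension X + dimension Y)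
    [set e | exists c d, [/\ atlas c, atlas d & e = prod_chart c d]].

(* The space [T] with the topology and the single global chart given by the
   embedding [f] into R^n, of which [g] is an inverse on the image. *)
Definition coord_space (R : realType) (T : choiceType) (n : nat)
    (f : T -> 'rV[R]_n) (g : 'rV[R]_n -> T) : space_with_charts R :=
  @SpaceWithCharts R (initial_topology f) n [set Chart [set: T] f g].

(** * The spaces C^r and Gl(r,C) *)

(* Real coordinates of a complex matrix: real parts, then imaginary parts. *)
Definition mx_coord (R : realType) (m n : nat) (A : 'M[R[i]]_(m, n)) :
    'rV[R]_(m * n + m * n) :=
  row_mx (mxvec (map_mx (@complex.Re R) A)) (mxvec (map_mx (@complex.Im R) A)).

Definition mx_of_coord (R : realType) (m n : nat)
    (w : 'rV[R]_(m * n + m * n)) : 'M[R[i]]_(m, n) :=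
  \matrix_(i, j) ((vec_mx (lsubmx w) : 'M[R]_(m, n)) i j +i*
                  (vec_mx (rsubmx w) : 'M[R]_(m, n)) i j).

Definition Cr_space (R : realType) (r : nat) : space_with_charts R :=
  @coord_space R 'rV[R[i]]_r _ (@mx_coord R 1 r) (@mx_of_coord R 1 r).

Definition GL (R : realType) (r : nat) := {A : 'M[R[i]]_r | A \in unitmx}.

Definition GL_one (R : realType) (r : nat) : GL R r :=
  exist _ 1%:M (unitmx1 R[i] r).

Definition GL_space (R : realType) (r : nat) : space_with_charts R :=
  @coord_space R (GL R r) _ (fun A => mx_coord (val A))
    (fun w => insubd (GL_one R r) (mx_of_coord w)).

(** * Fibre bundles *)

Definition local_triv (R : realType) (E M : manifold R)
    (F : space_with_charts R) (q : E -> M) (U : set M)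
    (tau : E -> prod_space M F) : Prop :=
  [/\ open U,
      forall e, U (q e) -> (tau e).1 = q e &
      exists tau', @diffeo_on R E (prod_space M F)
        (q @^-1` U) (U `*` [set: F]) tau tau'].

Definition fibre_bundle (R : realType) (E M : manifold R) (q : E -> M)
    (F : space_with_charts R) : Prop :=
  smooth q /\
  forall x, exists U (tau : E -> prod_space M F), U x /\ local_triv q U tau.

Definition fibre (S T : Type) (q : S -> T) (x : T) := {e : S | q e = x}.

Record global_section (R : realType) (E M : manifold R) (q : E -> M) :=
  GlobalSection {
    section_fun :> M -> E;
    section_smooth : smooth section_fun;
    sectionP : forall x, q (section_fun x) = x }.

Definition section_at (R : realType) (E M : manifold R) (q : E -> M)
    (s : global_section q) (x : M) : fibre q x := exist _ (s x) (sectionP s x).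

(** * Complex vector bundles *)

(* The complex vector space structure of the fibre of [p] over [x] is given by
   the vector space [vfibre x] and the bijection [vincl x] of [vfibre x] onto
   that fibre. *)
Record complex_vector_bundle (R : realType) (V M : manifold R) (p : V -> M)
    (r : nat) := ComplexVectorBundle {
  vfibre : M -> lmodType R[i];
  vincl : forall x, vfibre x -> V;
  vincl_inj : forall x, injective (vincl (x := x));
  vincl_range : forall x, range (vincl (x := x)) = p @^-1` [set x];
  vproj_smooth : smooth p;
  vtriv : forall x, exists U (tau : V -> prod_space M (Cr_space R r)),
    [/\ U x, local_triv p U tau &
        forall y, U y -> linear (fun a => (tau (@vincl y a)).2 : 'rV[R[i]]_r)] }.

Definition Clinear (R : realType) (U W : lmodType R[i]) (f : U -> W) : Prop :=
  linear f.

Definition Rlinear (R : realType) (U W : lmodType R[i]) (f : U -> W) : Prop :=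
  forall (k : R) (a b : U), f (k%:C *: a + b) = k%:C *: f a + f b.

Definition bundle_automorphism (R : realType) (V M : manifold R) (p : V -> M)
    (r : nat) (B : complex_vector_bundle p r)
    (lin : forall U W : lmodType R[i], (U -> W) -> Prop) (Phi : V -> V) : Prop :=
  diffeomorphism Phi /\
  forall x, exists x',
    Phi @` (p @^-1` [set x]) = p @^-1` [set x'] /\
    exists2 f : vfibre B x -> vfibre B x',
      lin _ _ f & forall a, Phi (vincl a) = vincl (f a).

Definition Rlinear_automorphism (R : realType) (V M : manifold R) (p : V -> M)
    (r : nat) (B : complex_vector_bundle p r) (Phi : V -> V) : Prop :=
  bundle_automorphism B (@Rlinear R) Phi.

Definition Clinear_automorphism (R : realType) (V M : manifold R) (p : V -> M)
    (r : nat) (B : complex_vector_bundle p r) (Phi : V -> V) : Prop :=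
  bundle_automorphism B (@Clinear R) Phi.

(* h_V(Phi) = phi; since [p] is onto, [phi] is determined by [Phi]. *)
Definition lifts (V M : Type) (p : V -> M) (phi : M -> M) (Phi : V -> V) : Prop :=
  forall v, p (Phi v) = phi (p v).

Definition Ciso (R : realType) (U W : lmodType R[i]) :=
  {f : U -> W | Clinear f /\ bijective f}.

Definition Clinear_lift (R : realType) (V M : manifold R) (p : V -> M)
    (r : nat) (B : complex_vector_bundle p r) (phi : M -> M) :=
  {Phi : V -> V | Clinear_automorphism B Phi /\ lifts p phi Phi}.

(* Pointwise identification: the point [s x] of the fibre of [q] over [x] is
   the isomorphism V_x -> V_(phi x) induced by the automorphism [Theta s].  A
   mere bijection between the two sets would carry much less information. *)
Definition sections_identified (R : realType) (V M : manifold R) (p : V -> M)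
    (r : nat) (B : complex_vector_bundle p r) (phi : M -> M)
    (E : manifold R) (q : E -> M) : Prop :=
  exists (iota : forall x, fibre q x -> Ciso (vfibre B x) (vfibre B (phi x)))
         (Theta : global_section q -> Clinear_lift B phi),
    [/\ forall x, bijective (iota x),
        bijective Theta &
        forall (s : global_section q) (x : M) (a : vfibre B x),
          sval (Theta s) (vincl a) = vincl (sval (iota x (section_at s x)) a)].

(* Main.v *)
(* The fibre of [E] over x consists of the complex isomorphisms from V_x to
   V_(phi x).  Fixing an arbitrary frame of every fibre V_x turns the set E into
   M x Gl(r,C), and trivializations (U,tau), (U',tau') of V give over
   U `&` phi^-1 U' the fibre coordinate A |-> H(x)^-1 A H'(phi x), with H and H'
   the changes of frame.  The coordinate changes A |-> g(x) A g'(phi x) involve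
   only transition functions of V, hence are smooth although H is not even
   continuous, and they glue to a manifold E; it is connected because
   Gl(r,C) is.  In these coordinates a smooth section and a smooth fibrewise
   linear lift of phi are the same smooth matrix-valued function; the inverse of
   a lift is smooth since matrix inversion is. *)
Require Import Defs.
From HB Require Import structures.
From mathcomp Require Import all_boot all_order all_algebra.
From mathcomp Require Import complex ring.
From mathcomp Require Import all_classical all_reals all_analysis.

Set Implicit Arguments.
Unset Strict Implicit.
Unset Printing Implicit Defensive.

Import Order.TTheory GRing.Theory Num.Theory numFieldNormedType.Exports.
Local Open Scope classical_set_scope.
Local Open Scope ring_scope.
Local Open Scope complex_scope.

(** * C^k functions on open subsets of R^m *)

(** The definitions use total functions, of which only the values on an open set count, and test
    smoothness in pairs of charts. The calculus is therefore reduced to real-valued functions, where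
    being C^k at a point depends only on the germ there; matrix-valued maps are then handled entry
    by entry, and inversion by Cramer's rule. The glued space is not a quotient of a disjoint union:
    its points are pairs in [M * F], and the cocycle enters only through the topology and the
    charts. Its index set, here all pairs of trivializations of V, may be uncountable, which is the
    difficulty in second countability. Lifts are studied along an arbitrary smooth map [alpha], not
    only along [phi]: the inverse of a lift of [phi] is a lift of the inverse of [phi], given by the
    inverse matrices with source and target trivializations exchanged. One smoothness argument thus
    serves for a lift and for its inverse. *)

Section SmoothCalculus.
Variable R : realType.

Lemma rV_continuous (S : topologicalType) n (f : S -> 'rV[R]_n) x :
  (forall j, {for x, continuous (fun x => f x 0 j)}) -> {for x, continuous f}.
Proof.
move=> cf.
apply: (iffRL (@cvgrPdist_le _ _ _ (nbhs x) (nbhs_filter x) f (f x))) => e e0.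
near=> y.
rewrite [leLHS]/Num.Def.normr/= mx_normrE (bigmax_le _ (ltW e0))//= => i _.
rewrite !mxE; move: i; near: y.
apply: (@filter_forall _ _ _ _ (nbhs_filter x)) => -[i j] /=.
by have /cvgrPdist_le/(_ _ e0) := cf j; rewrite !(ord1 i).
Unshelve. all: by end_near. Qed.

Lemma continuous_rV (S : topologicalType) n (f : S -> 'rV[R]_n) x j :
  {for x, continuous f} -> {for x, continuous (fun x => f x 0 j)}.
Proof.
move=> cf; apply: (@continuous_comp _ _ _ f (fun N => N 0 j)) => //.
exact: coord_continuous.
Qed.

(** Scalar counterpart of [Ck_on], on which products and inverses make sense; [Ck_onP] reduces
    vector-valued maps to it. *)
Fixpoint Ck_real (m k : nat) (U : set 'rV[R]_m) (f : 'rV[R]_m -> R) : Prop :=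
  match k with
  | 0%N => forall x, U x -> {for x, continuous f}
  | k'.+1 => (forall x, U x -> differentiable f x) /\
             (forall v : 'rV[R]_m, Ck_real k' U (fun x => 'D_v f x))
  end.

(** Each clause of [Ck_real] concerns the points of [U] one at a time, the derivatives being those
    of the total function. Taking [[set x]] for [U] thus expresses smoothness of the germ at [x]. *)
Lemma Ck_real_set1 m k (U : set 'rV[R]_m) f :
  Ck_real k U f <-> forall x, U x -> Ck_real k [set x] f.
Proof.
elim: k f => [|k IH] f /=; first by split=> [H x Ux y ->|H x Ux]; [exact: H|exact: H Ux x erefl].
split=> [[df Df] x Ux|H]; last first.
  by split=> [x /H[df _]|v]; [exact: df|apply/IH => x /H[_]; exact].
split=> [y -> |v]; first exact: df.
exact: (iffLR (IH _) (Df v)).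
Qed.

Lemma Ck_real_near m k x (f g : 'rV[R]_m -> R) :
  (\near x, f x = g x) -> Ck_real k [set x] f -> Ck_real k [set x] g.
Proof.
elim: k f g x => [|k IH] f g x fg /=.
  move=> cf _ ->; rewrite /prop_for /continuous_at.
  have := cf x erefl; rewrite /prop_for /continuous_at (nbhs_singleton fg).
  by move=> cfx P /cfx; apply: filterS2 fg => y /= ->.
move=> [df Df]; split=> [y ->|v].
  have /diff_locallyP[cf ef] := df _ erefl.
  (* The differential of [f] is proposed as first-order term for [g]; [diff_unique] then recognizes
     it as that of [g]. *)
  suff eg : g \o shift x = cst (g x) + 'd f x +o_ (0 : 'rV[R]_m) id.
    by apply/diff_locallyP; rewrite (diff_unique cf eg).
  rewrite -(nbhs_singleton fg).
  apply/eqaddoP => e e0; move/eqaddoP : ef => /(_ e e0) efe.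
  have fg0 : \forall y \near (0 : 'rV[R]_m), f (shift x y) = g (shift x y).
    by move: fg => /nbhs0P fg0; near=> z; rewrite /= addrC; near: z.
  near=> z; rewrite !fctE /= -[g (z + x)](near fg0 z) //.
  by near: z; exact: efe.
apply: IH (Df v); near=> y; apply: near_eq_derive.
by near: y; exact: (near_join fg).
Unshelve. all: by end_near. Qed.

Lemma Ck_real_ext m k (U : set 'rV[R]_m) f g : open U ->
  (forall x, U x -> f x = g x) -> Ck_real k U f -> Ck_real k U g.
Proof.
move=> oU fg /Ck_real_set1 Uf; apply/Ck_real_set1 => x Ux.
apply: Ck_real_near (Uf x Ux).
by have := open_nbhs_nbhs (conj oU Ux); apply: filterS => y /fg.
Qed.

Lemma Ck_real_sub m k (U V : set 'rV[R]_m) f : V `<=` U -> Ck_real k U f -> Ck_real k V f.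
Proof. by move=> VU /Ck_real_set1 H; apply/Ck_real_set1 => x /VU/H. Qed.

Lemma Ck_realW m k (U : set 'rV[R]_m) f : Ck_real k.+1 U f -> Ck_real k U f.
Proof.
elim: k f => [|k IH] f [df Df]; first by move=> x /df/differentiable_continuous.
by split=> // v; apply: IH; exact: Df.
Qed.

Lemma Ck_real_cst m k (U : set 'rV[R]_m) a : Ck_real k U (cst a).
Proof.
elim: k a => [|k IH] a /=; first by move=> x _; apply: cst_continuous.
split=> [x _|v]; first exact: differentiable_cst.
by rewrite (_ : (fun x => _) = cst 0) //; apply/funext => x; exact: derive_cst.
Qed.

Lemma Ck_real_coord m k (U : set 'rV[R]_m) j : Ck_real k U (fun x => x 0 j).
Proof.
case: k => [|k] /=; first by move=> x _; exact: coord_continuous.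
split=> [x _|v]; first exact: differentiable_coord.
rewrite (_ : (fun x => _) = cst (v 0 j)); first exact: Ck_real_cst.
apply/funext => x.
have -> : cst (v 0 j) x = ('D_v id x) 0 j by rewrite derive_id.
by rewrite derive_mx ?mxE//; exact: derivable_id.
Qed.

Lemma Ck_realD m k (U : set 'rV[R]_m) f g : open U ->
  Ck_real k U f -> Ck_real k U g -> Ck_real k U (fun x => f x + g x).
Proof.
move=> oU; elim: k f g => [|k IH] f g.
  by move=> cf cg x Ux; exact: cvgD (cf x Ux) (cg x Ux).
move=> [df Df] [dg Dg]; split=> [x Ux|v].
  exact: differentiableD (df x Ux) (dg x Ux).
apply: (Ck_real_ext oU) (IH _ _ (Df v) (Dg v)) => x Ux /=.
apply/esym/deriveD; apply: diff_derivable; [exact: df|exact: dg].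
Qed.

Lemma Ck_realM m k (U : set 'rV[R]_m) f g : open U ->
  Ck_real k U f -> Ck_real k U g -> Ck_real k U (fun x => f x * g x).
Proof.
move=> oU; elim: k f g => [|k IH] f g.
  by move=> cf cg x Ux; exact: cvgM (cf x Ux) (cg x Ux).
move=> Cf Cg; have [df Df] := Cf; have [dg Dg] := Cg; split=> [x Ux|v].
  exact: differentiableM (df x Ux) (dg x Ux).
apply: (Ck_real_ext oU) (Ck_realD oU (IH _ _ (Ck_realW Cf) (Dg v)) (IH _ _ (Ck_realW Cg) (Df v))).
move=> x Ux /=.
by apply/esym/deriveM; apply: diff_derivable; [exact: df|exact: dg].
Qed.

Lemma Ck_realV m k (U : set 'rV[R]_m) f : open U -> (forall x, U x -> f x != 0) ->
  Ck_real k U f -> Ck_real k U (fun x => (f x)^-1).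
Proof.
move=> oU f0; elim: k f f0 => [|k IH] f f0.
  by move=> cf x Ux; exact: cvgV (f0 x Ux) (cf x Ux).
move=> Cf; have [df Df] := Cf; split=> [x Ux|v].
  by apply: differentiableV; [exact: df|exact: f0].
have Cf' := IH _ f0 (Ck_realW Cf).
(* The derivative of 1/f is -(1/f)^2 times that of f, and 1/f is already C^k by induction. *)
apply: (Ck_real_ext oU)
  (Ck_realM oU (@Ck_real_cst _ _ _ (-1)) (Ck_realM oU (Ck_realM oU Cf' Cf') (Df v))).
move=> x Ux /=; rewrite mulN1r.
rewrite [RHS]deriveV ?f0//; last by apply: diff_derivable; exact: df.
by rewrite -exprVn expr2 scaleNr.
Qed.

Lemma Ck_real_sum m k (U : set 'rV[R]_m) I (s : seq I) (f : I -> 'rV[R]_m -> R) :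
  open U -> (forall i, Ck_real k U (f i)) -> Ck_real k U (fun x => \sum_(i <- s) f i x).
Proof.
move=> oU Cf; elim: s => [|i s IH].
  by rewrite (_ : (fun x => _) = cst 0); [exact: Ck_real_cst|apply/funext => x; rewrite big_nil].
rewrite (_ : (fun x => _) = (fun x => f i x + \sum_(i <- s) f i x)).
  exact: Ck_realD.
by apply/funext => x; rewrite big_cons.
Qed.

Lemma differentiable_rV m n (f : 'rV[R]_m -> 'rV[R]_n) x :
  (forall j, differentiable (fun x => f x 0 j) x) -> differentiable f x.
Proof.
move=> df; rewrite (_ : f = \sum_(j < n) (fun x => f x 0 j *: delta_mx 0 j)).
  by apply: differentiable_sum => j; exact: differentiableZl.
by apply/funext => y; rewrite fct_sumE -row_sum_delta.
Qed.

Lemma Ck_onP m n k (U : set 'rV[R]_m) (f : 'rV[R]_m -> 'rV[R]_n) : open U ->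
  Ck_on k U f <-> forall j, Ck_real k U (fun x => f x 0 j).
Proof.
move=> oU; elim: k f => [|k IH] f /=.
  split=> [cf j x Ux|cf x Ux].
    exact/continuous_rV/cf.
  by apply: rV_continuous => j; exact: cf.
have derE v x : differentiable f x -> forall j, ('D_v f x) 0 j = 'D_v (fun x => f x 0 j) x.
  by move=> df j; rewrite derive_mx ?mxE//; exact: diff_derivable.
have dcrd j x : differentiable f x -> differentiable (fun x => f x 0 j) x.
  move=> df; apply: (differentiable_comp df (differentiable_coord _ _ _)).
split=> [[df Df] j|H].
  split=> [x Ux|v]; first exact/dcrd/df.
  by apply: (Ck_real_ext oU) (iffLR (IH _) (Df v) j) => x /df/derE.
have df x : U x -> differentiable f x.
  by move=> Ux; apply: differentiable_rV => j; have [+ _] := H j; exact.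
split=> // v; apply/IH => j; have [_ /(_ v)] := H j.
by apply: Ck_real_ext => // x /df/derE.
Qed.

Lemma Ck_real_comp m n k (U : set 'rV[R]_m) (U' : set 'rV[R]_n) f g :
  open U -> (forall x, U x -> U' (f x)) ->
  Ck_on k U f -> Ck_real k U' g -> Ck_real k U (fun x => g (f x)).
Proof.
move=> oU UU'; elim: k f g UU' => [|k IH] f g UU'.
  by move=> cf cg x Ux; apply: continuous_comp; [exact: cf|exact/cg/UU'].
move=> Cf; have /= [df Df] := Cf; move=> /= [dg Dg].
split=> [x Ux|v]; first by apply: differentiable_comp; [exact: df|exact/dg/UU'].
have Cfk : Ck_on k U f.
  by apply/Ck_onP => // j; apply: Ck_realW; move: j; apply/Ck_onP.
(* Chain rule in coordinates. Each partial derivative of [g] is composed with [f] taken as a C^k map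
   only, so the induction hypothesis applies. *)
apply: (@Ck_real_ext _ _ _ (fun x => \sum_(j <- enum 'I_n)
   ('D_v f x) 0 j * 'D_(delta_mx 0 j) g (f x)) _ oU); last first.
  apply: Ck_real_sum => // j; apply: Ck_realM => //; first by move: j; apply/Ck_onP.
  exact: IH Cfk (Dg _).
move=> x Ux; have dfx := df x Ux; have dgfx := dg _ (UU' _ Ux).
rewrite [RHS]deriveE; last exact: differentiable_comp.
rewrite diff_comp//= -[('d f x : _ -> _) v]deriveE// [X in 'd g _ X]row_sum_delta.
by rewrite linear_sum big_enum; apply: eq_bigr => j _; rewrite linearZ/= -deriveE.
Qed.

End SmoothCalculus.

(** * Smooth maps between spaces with charts *)

Section PartialContinuity.
Variables S T : topologicalType.

(** Since [f] is total but continuous only on [U], preimages become open after intersection with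
    [U]; the chart domains and overlaps below have this shape. *)
Lemma open_setI_preimage (U : set S) (f : S -> T) (O : set T) :
  open U -> (forall x, U x -> {for x, continuous f}) -> open O ->
  open (U `&` f @^-1` O).
Proof.
move=> oU cf oO; rewrite openE => x [Ux Ofx]; apply: filterI.
  exact: open_nbhs_nbhs.
by apply: (cf x Ux); exact: open_nbhs_nbhs.
Qed.

Lemma near_continuous (f g : S -> T) x :
  (\forall y \near x, f y = g y) -> {for x, continuous f} -> {for x, continuous g}.
Proof.
move=> fg cf P; rewrite -(nbhs_singleton fg) => /cf; apply: filterS2 fg.
by move=> y /= ->.
Qed.

Lemma open_continuous (U : set S) (f g : S -> T) x : open U -> U x ->
  (forall y, U y -> f y = g y) -> {for x, continuous f} -> {for x, continuous g}.
Proof.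
move=> oU Ux fg; apply: near_continuous.
by have := open_nbhs_nbhs (conj oU Ux); apply: filterS.
Qed.

End PartialContinuity.

Section SmoothFunctions.
Variable R : realType.
Implicit Types X Y Z : space_with_charts R.

Definition Cinf_real m (U : set 'rV[R]_m) (f : 'rV[R]_m -> R) := forall k, Ck_real k U f.

Lemma Cinf_onP m n (U : set 'rV[R]_m) (f : 'rV[R]_m -> 'rV[R]_n) : open U ->
  Cinf_on U f <-> forall j, Cinf_real U (fun x => f x 0 j).
Proof.
move=> oU; split=> [Cf j k|Cf k]; first by move: j; apply/Ck_onP.
by apply/Ck_onP => // j; exact: Cf.
Qed.

(** The manifold axioms on which the calculus rests, isolated because products, C^r and GL(r,C) are
    used without being packed as manifolds. *)
Definition charted X : Prop :=
  (forall c : chart R X (dimension X), atlas c -> is_chart c) /\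
  (forall x : X, exists2 c, atlas c & chart_dom c x).

Lemma manifold_charted (M : manifold R) : charted M.
Proof. by have [] := manifoldP M. Qed.

Lemma chart_funK X (c : chart R X (dimension X)) x :
  is_chart c -> chart_dom c x -> chart_inv c (chart_fun c x) = x.
Proof. by move=> [_ _ cK _ _] /cK. Qed.

Lemma open_chart_image X (c : chart R X (dimension X)) (A : set X) :
  is_chart c -> open A -> open (chart_fun c @` (A `&` chart_dom c)).
Proof.
move=> [oD oI cK cf ci] oA.
rewrite (_ : _ @` _ = chart_img c `&` chart_inv c @^-1` A).
  exact: open_setI_preimage.
apply/seteqP; split=> [y [x [Ax cx] <-]|y [[x cx <-] Ax]].
  by split; [exists x|rewrite /= cK].
by exists x => //; split=> //; move: Ax; rewrite /= cK.
Qed.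

(** Continuity is not a separate clause as in [smooth_on]: with no chart on the target it follows
    from order 0, see [rsmooth_continuous]. *)
Definition rsmooth X (A : set X) (g : X -> R) : Prop :=
  forall c : chart R X (dimension X), atlas c ->
    Cinf_real (chart_fun c @` (A `&` chart_dom c)) (fun y => g (chart_inv c y)).

Lemma rsmooth_sub X (A B : set X) g : B `<=` A -> rsmooth A g -> rsmooth B g.
Proof.
move=> BA Cg c ac k; apply: Ck_real_sub (Cg c ac k).
by move=> _ [x [/BA Ax cx] <-]; exists x.
Qed.

Lemma rsmooth_ext X (A : set X) g h : charted X -> open A ->
  (forall x, A x -> g x = h x) -> rsmooth A g -> rsmooth A h.
Proof.
move=> [cX _] oA gh Cg c ac k; apply: Ck_real_ext (Cg c ac k).
  by apply: open_chart_image => //; exact: cX.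
by move=> _ [x [Ax cx] <-]; rewrite chart_funK; [exact: gh|exact: cX|].
Qed.

(** Smoothness at a point already looks at a whole neighbourhood of it, so the sets [B] only have to
    cover [A]. *)
Lemma rsmooth_local X (A : set X) g :
  (forall x, A x -> exists2 B : set X, B x & rsmooth B g) -> rsmooth A g.
Proof.
move=> loc c ac k; apply/Ck_real_set1 => _ [x [Ax cx] <-].
have [B Bx /(_ c ac k)/Ck_real_set1] := loc x Ax; apply.
by exists x.
Qed.

Lemma rsmooth_cst X (A : set X) a : rsmooth A (cst a).
Proof. by move=> c ac k; exact: Ck_real_cst. Qed.

Section Algebra.
Variables (X : space_with_charts R) (A : set X).
Hypotheses (chX : charted X) (oA : open A).

Let oI c : atlas c -> open (chart_fun c @` (A `&` chart_dom c)).
Proof. by move=> ac; apply: open_chart_image => //; exact: chX.1. Qed.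

Lemma rsmoothD g h : rsmooth A g -> rsmooth A h -> rsmooth A (fun x => g x + h x).
Proof. by move=> Cg Ch c ac k; apply: Ck_realD (oI ac) (Cg c ac k) (Ch c ac k). Qed.

Lemma rsmoothM g h : rsmooth A g -> rsmooth A h -> rsmooth A (fun x => g x * h x).
Proof. by move=> Cg Ch c ac k; apply: Ck_realM (oI ac) (Cg c ac k) (Ch c ac k). Qed.

Lemma rsmoothN g : rsmooth A g -> rsmooth A (fun x => - g x).
Proof.
move=> Cg; apply: (rsmooth_ext chX oA _ (rsmoothM (@rsmooth_cst _ _ (-1)) Cg)) => x _.
exact: mulN1r.
Qed.

Lemma rsmoothV g : (forall x, A x -> g x != 0) -> rsmooth A g -> rsmooth A (fun x => (g x)^-1).
Proof.
move=> g0 Cg c ac k; apply: Ck_realV (oI ac) _ (Cg c ac k) => _ [x [Ax cx] <-].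
by rewrite chart_funK; [exact: g0|exact: chX.1|].
Qed.

Lemma rsmooth_continuous g x : rsmooth A g -> A x -> {for x, continuous g}.
Proof.
move=> Cg Ax; have [c ac cx] := chX.2 x.
have [oD _ cK cf _] := chX.1 c ac.
apply: (@open_continuous _ _ _ (fun y => g (chart_inv c (chart_fun c y))) _ _ oD cx).
  by move=> y cy; rewrite cK.
apply: (@continuous_comp _ _ _ (chart_fun c) (fun z => g (chart_inv c z))).
  exact: cf.
by apply: (Cg c ac 0%N); exists x.
Qed.

End Algebra.

(** Leaves only the target charts in sight, so that maps are accessible to the algebra of scalar
    functions. Continuity makes the domains open, as [Cinf_onP] requires. *)
Lemma smooth_on_rsmooth X Y (A : set X) (f : X -> Y) : charted X -> charted Y ->
  open A ->
  smooth_on A f <->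
  (forall x, A x -> {for x, continuous f}) /\
  forall d, atlas d -> forall j,
    rsmooth (A `&` f @^-1` chart_dom d) (fun x => chart_fun d (f x) 0 j).
Proof.
move=> [cX _] [cY _] oA.
have E c d : chart_fun c @` (A `&` chart_dom c `&` f @^-1` chart_dom d) =
             chart_fun c @` (A `&` f @^-1` chart_dom d `&` chart_dom c).
  by rewrite setIAC.
have oE c d : (forall x, A x -> {for x, continuous f}) -> atlas c -> atlas d ->
    open (chart_fun c @` (A `&` f @^-1` chart_dom d `&` chart_dom c)).
  move=> cf ac ad; apply: open_chart_image (cX _ ac) _.
  by apply: open_setI_preimage => //; have [] := cY _ ad.
split=> -[cf Cf]; (split; first exact: cf); [move=> d ad j c ac|move=> c d ac ad].
  by move: (Cf c d ac ad); rewrite E => /Cinf_onP; apply; exact: oE.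
by rewrite E; apply/Cinf_onP => [|j]; [exact: oE|exact: Cf].
Qed.

Lemma rsmooth_comp X Y (A : set X) (B : set Y) (f : X -> Y) g :
  charted X -> charted Y -> open A -> open B -> smooth_on A f ->
  (forall x, A x -> B (f x)) -> rsmooth B g -> rsmooth A (fun x => g (f x)).
Proof.
move=> chX chY oA oB /(smooth_on_rsmooth _ chX chY oA)[cf Cf] AB Cg.
apply: rsmooth_local => x Ax; have [d ad dfx] := chY.2 (f x).
have [oD _ dK _ _] := chY.1 d ad.
pose A' := A `&` f @^-1` chart_dom d.
have oA' : open A' by exact: open_setI_preimage.
exists A' => // c ac k; have cc := chX.1 c ac.
have oI := open_chart_image cc oA'.
(* A chart [d] around [f x] is inserted between [f] and [g], which turns the composite into one of
   maps between Euclidean spaces. *)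
apply: (@Ck_real_ext _ _ _ _ (fun y => g (chart_inv d (chart_fun d (f (chart_inv c y)))))) => //.
  by move=> _ [z [[Az dz] cz] <-]; rewrite (chart_funK cc)// dK.
apply: (@Ck_real_comp _ _ _ _ _ (chart_fun d @` (B `&` chart_dom d))
   (fun y => chart_fun d (f (chart_inv c y))) _ oI _ _ (Cg d ad k)).
  move=> _ [z [[Az dz] cz] <-]; rewrite (chart_funK cc)//.
  by exists (f z) => //; split=> //; exact: AB.
by apply/Ck_onP => // j; exact: Cf.
Qed.

Lemma smooth_on_comp X Y Z (A : set X) (B : set Y) (f : X -> Y) (g : Y -> Z) :
  charted X -> charted Y -> charted Z -> open A -> open B -> smooth_on A f ->
  (forall x, A x -> B (f x)) -> smooth_on B g -> smooth_on A (fun x => g (f x)).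
Proof.
move=> chX chY chZ oA oB sf AB sg; have [cf _] := sf; have [cg Cg] := sg.
apply/(smooth_on_rsmooth _ chX chZ oA); split.
  by move=> x Ax; apply: (@continuous_comp _ _ _ f g); [exact: cf|exact/cg/AB].
move=> d ad j; have [oD _ _ _ _] := chZ.1 d ad.
have oB' : open (B `&` g @^-1` chart_dom d) by exact: open_setI_preimage.
have oA' : open (A `&` f @^-1` (B `&` g @^-1` chart_dom d)).
  exact: open_setI_preimage.
have -> : A `&` (fun x => g (f x)) @^-1` chart_dom d =
    A `&` f @^-1` (B `&` g @^-1` chart_dom d).
  by apply/seteqP; split=> [x [Ax dx]|x [Ax [Bx dx]]]; split=> //; split=> //; exact: AB.
apply: (@rsmooth_comp _ _ _ _ _ (fun y => chart_fun d (g y) 0 j) chX chY oA' oB').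
- apply/(smooth_on_rsmooth _ chX chY oA'); split; first by move=> x [/cf].
  move=> e ae i; apply: rsmooth_sub (proj2 (iffLR (smooth_on_rsmooth _ chX chY oA) sf) e ae i).
  by move=> x [[Ax _] ex].
- by move=> x [].
- exact: (proj2 (iffLR (smooth_on_rsmooth _ chY chZ oB) sg)).
Qed.

Lemma smooth_on_sub X Y (A B : set X) (f : X -> Y) : charted X -> charted Y ->
  open A -> open B -> B `<=` A -> smooth_on A f -> smooth_on B f.
Proof.
move=> chX chY oA oB BA /(smooth_on_rsmooth _ chX chY oA)[cf Cf].
apply/(smooth_on_rsmooth _ chX chY oB); split; first by move=> x /BA/cf.
by move=> d ad j; apply: rsmooth_sub (Cf d ad j); exact: setSI.
Qed.

Lemma smooth_on_local X Y (A : set X) (f : X -> Y) : charted X -> charted Y ->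
  open A ->
  (forall x, A x -> exists B : set X, [/\ open B, B x & smooth_on B f]) ->
  smooth_on A f.
Proof.
move=> chX chY oA loc; apply/(smooth_on_rsmooth _ chX chY oA); split.
  by move=> x /loc[B [_ Bx [+ _]]]; exact.
move=> d ad j; apply: rsmooth_local => x [Ax dx].
have [B [oB Bx /(smooth_on_rsmooth _ chX chY oB)[_ Cf]]] := loc x Ax.
by exists (B `&` f @^-1` chart_dom d) => //; exact: Cf.
Qed.

Lemma smooth_on_ext X Y (A : set X) (f g : X -> Y) : charted X -> charted Y ->
  open A -> (forall x, A x -> f x = g x) -> smooth_on A f -> smooth_on A g.
Proof.
move=> chX chY oA fg /(smooth_on_rsmooth _ chX chY oA)[cf Cf].
apply/(smooth_on_rsmooth _ chX chY oA); split.
  by move=> x Ax; apply: open_continuous oA Ax fg (cf x Ax).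
move=> d ad j; have [oD _ _ _ _] := chY.1 d ad.
have E : A `&` f @^-1` chart_dom d = A `&` g @^-1` chart_dom d.
  by apply/seteqP; split=> x [Ax] /=; [rewrite fg|rewrite -fg].
rewrite -E; apply: rsmooth_ext (Cf d ad j) => //.
  exact: open_setI_preimage.
by move=> x [Ax _]; rewrite fg.
Qed.

End SmoothFunctions.

(** * Products and spaces with one global chart *)

Section ProductSpaces.
Variable R : realType.
Implicit Types X Y Z : space_with_charts R.

(** Smoothness of chart changes in scalar form; it is what makes the identity and the projections
    smooth. *)
Definition compatible X : Prop :=
  forall d : chart R X (dimension X), atlas d ->
  forall j, rsmooth (chart_dom d) (fun x => chart_fun d x 0 j).

Lemma manifold_compatible (M : manifold R) : compatible M.
Proof.
move=> d ad j c ac; have [_ _ _ _ /(_ c d ac ad)] := manifoldP M.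
rewrite setIC => /Cinf_onP; apply.
apply: open_chart_image; first by have [+ _] := manifold_charted M; exact.
by have [/(_ d ad)[]] := manifold_charted M.
Qed.

Lemma smooth_on_id X (A : set X) : charted X -> compatible X -> open A ->
  smooth_on A (fun x => x).
Proof.
move=> chX coX oA; apply/(smooth_on_rsmooth _ chX chX oA).
split; first by move=> x _; exact: cvg_id.
by move=> d ad j; apply: rsmooth_sub (coX d ad j) => x [].
Qed.

Lemma smooth_on_cst X Y (A : set X) (b : Y) : charted X -> charted Y -> open A ->
  smooth_on A (fun _ => b).
Proof.
move=> chX chY oA; apply/(smooth_on_rsmooth _ chX chY oA).
split; first by move=> x _; exact: cvg_cst.
by move=> d ad j; exact: rsmooth_cst.
Qed.

Lemma fst_continuous (S T : topologicalType) : continuous (@fst S T).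
Proof. by move=> x; exact: cvg_fst. Qed.

Lemma snd_continuous (S T : topologicalType) : continuous (@snd S T).
Proof. by move=> x; exact: cvg_snd. Qed.

Lemma open_setX (S T : topologicalType) (A : set S) (B : set T) :
  open A -> open B -> open (A `*` B).
Proof.
move=> oA oB; rewrite (_ : A `*` B = fst @^-1` A `&` snd @^-1` B) //.
apply: openI; apply: open_comp => // x _; [exact: fst_continuous|exact: snd_continuous].
Qed.

Lemma row_mx_continuous (S : topologicalType) m n (f : S -> 'rV[R]_m) (g : S -> 'rV[R]_n) x :
  {for x, continuous f} -> {for x, continuous g} ->
  {for x, continuous (fun x => row_mx (f x) (g x))}.
Proof.
move=> cf cg; apply: rV_continuous => j; case: (split_ordP j) => k ->.
  by rewrite (funext (fun y => row_mxEl (f y) (g y) 0 k)); exact: continuous_rV.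
by rewrite (funext (fun y => row_mxEr (f y) (g y) 0 k)); exact: continuous_rV.
Qed.

Lemma pair_continuous (S T U : topologicalType) (f : S -> T) (g : S -> U) x :
  {for x, continuous f} -> {for x, continuous g} ->
  {for x, continuous (fun x => (f x, g x))}.
Proof. by move=> cf cg; apply: cvg_pair. Qed.

Lemma prod_is_chart X Y c d : is_chart (c : chart R X (dimension X)) ->
  is_chart (d : chart R Y (dimension Y)) ->
  is_chart (prod_chart c d : chart R (prod_space X Y) _).
Proof.
move=> [oc ic cK cc ci] [od id dK cd di].
have imgE : chart_img (prod_chart c d) = lsubmx @^-1` chart_img c `&` rsubmx @^-1` chart_img d.
  apply/seteqP; split=> [_ [[x y] [/= cx dy] <-]|w [[x cx lw] [y dy rw]]].
    by split; rewrite /= ?row_mxKl ?row_mxKr; [exists x|exists y].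
  by exists (x, y) => //=; rewrite lw rw hsubmxK.
split.
- exact: open_setX.
- rewrite imgE; apply: openI; apply: open_comp => // w _.
    exact: continuous_lsubmx.
  exact: continuous_rsubmx.
- by move=> [x y] [/= cx dy]; rewrite row_mxKl row_mxKr cK ?dK.
- move=> [x y] [/= cx dy]; apply: row_mx_continuous.
    apply: (@continuous_comp _ _ _ fst (chart_fun c)); first exact: fst_continuous.
    exact: cc.
  apply: (@continuous_comp _ _ _ snd (chart_fun d)); first exact: snd_continuous.
  exact: cd.
- move=> w; rewrite imgE => -[/= cw dw]; apply: pair_continuous.
    apply: (@continuous_comp _ _ _ lsubmx (chart_inv c)); first exact: continuous_lsubmx.
    exact: ci.
  apply: (@continuous_comp _ _ _ rsubmx (chart_inv d)); first exact: continuous_rsubmx.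
  exact: di.
Qed.

Lemma prod_charted X Y : charted X -> charted Y -> charted (prod_space X Y).
Proof.
move=> [chX coX] [chY coY]; split=> [e [c [d [ac ad ->]]]|[x y]].
  by apply: prod_is_chart; [exact: chX|exact: chY].
have [c ac cx] := coX x; have [d ad dy] := coY y.
by exists (prod_chart c d) => //; exists c, d.
Qed.

(** In a product chart, [fst] is the extraction of the left block of coordinates. *)
Lemma rsmooth_fst X Y (A : set X) g : charted X -> charted Y -> open A -> rsmooth A g ->
  rsmooth (fst @^-1` A : set (prod_space X Y)) (fun z => g z.1).
Proof.
move=> chX chY oA Cg e [c [d [ac ad ->]]] k /=.
have oE := open_chart_image (prod_is_chart (chX.1 c ac) (chY.1 d ad))
  (open_comp (fun x _ => @fst_continuous X Y x) oA).
apply: (Ck_real_comp oE _ _ (Cg c ac k)).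
  by move=> _ [[x y] [/= Ax [/= cx dy]] <-]; rewrite row_mxKl; exists x.
apply/Ck_onP => // j;
rewrite (_ : (fun x => _) = (fun x : 'rV_(dimension X + dimension Y) => x 0 (lshift _ j))).
  exact: Ck_real_coord.
by apply/funext => x; rewrite mxE.
Qed.

Lemma rsmooth_snd X Y (A : set Y) g : charted X -> charted Y -> open A -> rsmooth A g ->
  rsmooth (snd @^-1` A : set (prod_space X Y)) (fun z => g z.2).
Proof.
move=> chX chY oA Cg e [c [d [ac ad ->]]] k /=.
have oE := open_chart_image (prod_is_chart (chX.1 c ac) (chY.1 d ad))
  (open_comp (fun x _ => @snd_continuous X Y x) oA).
apply: (Ck_real_comp oE _ _ (Cg d ad k)).
  by move=> _ [[x y] [/= Ax [/= cx dy]] <-]; rewrite row_mxKr; exists y.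
apply/Ck_onP => // j;
rewrite (_ : (fun x => _) = (fun x : 'rV_(dimension X + dimension Y) => x 0 (rshift _ j))).
  exact: Ck_real_coord.
by apply/funext => x; rewrite mxE.
Qed.

Lemma smooth_on_fst X Y (A : set (prod_space X Y)) : charted X -> charted Y ->
  compatible X -> open A -> smooth_on A (fst : prod_space X Y -> X).
Proof.
move=> chX chY coX oA; have chP := prod_charted chX chY.
apply/(smooth_on_rsmooth _ chP chX oA); split; first by move=> x _; exact: fst_continuous.
move=> d ad j; have od : open (chart_dom d) by have [] := chX.1 d ad.
by apply: rsmooth_sub (rsmooth_fst chX chY od (coX d ad j)) => x [].
Qed.

Lemma smooth_on_snd X Y (A : set (prod_space X Y)) : charted X -> charted Y ->
  compatible Y -> open A -> smooth_on A (snd : prod_space X Y -> Y).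
Proof.
move=> chX chY coX oA; have chP := prod_charted chX chY.
apply/(smooth_on_rsmooth _ chP chY oA); split; first by move=> x _; exact: snd_continuous.
move=> d ad j; have od : open (chart_dom d) by have [] := chY.1 d ad.
by apply: rsmooth_sub (rsmooth_snd chX chY od (coX d ad j)) => x [].
Qed.

Lemma smooth_on_pair X Y Z (A : set Z) (f : Z -> X) (g : Z -> Y) :
  charted X -> charted Y -> charted Z -> open A -> smooth_on A f -> smooth_on A g ->
  smooth_on A ((fun z => (f z, g z)) : Z -> prod_space X Y).
Proof.
move=> chX chY chZ oA.
move=> /(smooth_on_rsmooth _ chZ chX oA)[cf Cf] /(smooth_on_rsmooth _ chZ chY oA)[cg Cg].
apply/(smooth_on_rsmooth _ chZ (prod_charted chX chY) oA); split.
  by move=> z Az; apply: pair_continuous; [exact: cf|exact: cg].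
move=> e [c [d [ac ad ->]]] j; case: (split_ordP j) => k ->.
  rewrite (_ : (fun x => _) = (fun x => chart_fun c (f x) 0 k)).
    by apply: rsmooth_sub (Cf c ac k) => z [Az []].
  by apply/funext => z; rewrite row_mxEl.
rewrite (_ : (fun x => _) = (fun x => chart_fun d (g x) 0 k)).
  by apply: rsmooth_sub (Cg d ad k) => z [Az []].
by apply/funext => z; rewrite row_mxEr.
Qed.

End ProductSpaces.

Lemma initial_continuous_for (S : choiceType) (T U : topologicalType)
  (w : S -> T) (f : U -> initial_topology w) x :
  {for x, continuous (fun y => w (f y))} -> {for x, continuous f}.
Proof.
move=> cf V [_ [[W oW <-] /= Wfx]] /filterS; apply; apply: cf.
exact: open_nbhs_nbhs.
Qed.

Section CoordSpaces.
Variables (R : realType) (T : choiceType) (n : nat).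
Variables (f : T -> 'rV[R]_n) (g : 'rV[R]_n -> T).
Hypotheses (fK : cancel f g) (open_range : open (range f)).

(** Continuity of [g] into the initial topology amounts to continuity of [f \o g], which is the
    identity on the open set [range f]. *)
Lemma coord_charted : charted (coord_space f g).
Proof.
have cf : continuous (f : initial_topology f -> 'rV[R]_n) by exact: initial_continuous.
split=> [c ->|x]; last by exists (Chart setT f g).
split=> //=; first exact: openT.
  by move=> x _; exact: cf.
move=> _ [x _ <-]; apply: initial_continuous_for.
apply: (@open_continuous _ _ (range f) id (fun y => f (g y)) (f x) open_range).
- by exists x.
- by move=> _ [y _ <-]; rewrite /= fK.
- by move=> P.
Qed.

Lemma coord_compatible : compatible (coord_space f g).
Proof.
move=> d -> j c -> k /=; apply: (Ck_real_ext _ _ (Ck_real_coord _ _ j)).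
  by rewrite setIT.
by move=> _ [x _ <-]; rewrite fK.
Qed.

(** The topology is pulled back along [f], so continuity of [F] follows from that of its smooth
    coordinates. *)
Lemma smooth_on_coord (X : space_with_charts R) (A : set X) (F : X -> coord_space f g) :
  charted X -> open A -> smooth_on A F <-> forall j, rsmooth A (fun x => f (F x) 0 j).
Proof.
move=> chX oA; split=> [/(smooth_on_rsmooth _ chX coord_charted oA)[_ CF] j|CF].
  by have := CF _ erefl j; rewrite preimage_setT setIT.
apply/(smooth_on_rsmooth _ chX coord_charted oA); split; last first.
  by move=> d -> j; rewrite preimage_setT setIT; exact: CF.
move=> x Ax; apply: initial_continuous_for.
by apply: rV_continuous => j; exact: rsmooth_continuous (CF j) Ax.
Qed.

End CoordSpaces.

(** * Smooth matrix-valued functions and the manifold GL(r,C) *)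

Section ComplexMatrices.
Variable R : realType.
Local Notation C := R[i].
Local Notation Re := (@complex.Re R).
Local Notation Im := (@complex.Im R).

Section SmoothComplex.
Variables (X : space_with_charts R) (A : set X).
Hypotheses (chX : charted X) (oA : open A).

Definition csmooth (g : X -> C) : Prop :=
  rsmooth A (fun x => Re (g x)) /\ rsmooth A (fun x => Im (g x)).

Lemma csmooth_ext g h : (forall x, A x -> g x = h x) -> csmooth g -> csmooth h.
Proof.
move=> gh [Cr Ci]; split.
  by apply: rsmooth_ext Cr => // x Ax; rewrite gh.
by apply: rsmooth_ext Ci => // x Ax; rewrite gh.
Qed.

Lemma csmooth_cst a : csmooth (fun _ => a).
Proof. by split; exact: rsmooth_cst. Qed.

Lemma csmoothD g h : csmooth g -> csmooth h -> csmooth (fun x => g x + h x).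
Proof.
move=> [gr gi] [hr hi]; split.
  by apply: rsmooth_ext (rsmoothD chX oA gr hr) => // x _; case: (g x); case: (h x).
by apply: rsmooth_ext (rsmoothD chX oA gi hi) => // x _; case: (g x); case: (h x).
Qed.

Lemma csmoothM g h : csmooth g -> csmooth h -> csmooth (fun x => g x * h x).
Proof.
move=> [gr gi] [hr hi]; split.
  apply: rsmooth_ext (rsmoothD chX oA (rsmoothM chX oA gr hr)
    (rsmoothN chX oA (rsmoothM chX oA gi hi))) => //.
  by move=> x _; case: (g x) => a b; case: (h x).
apply: rsmooth_ext (rsmoothD chX oA (rsmoothM chX oA gr hi) (rsmoothM chX oA gi hr)) => //.
by move=> x _; case: (g x) => a b; case: (h x).
Qed.

Lemma csmoothV g : (forall x, A x -> g x != 0) -> csmooth g -> csmooth (fun x => (g x)^-1).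
Proof.
move=> g0 [gr gi].
(* The squared modulus: 1/g has real part Re g / q and imaginary part - Im g / q. *)
pose q x := Re (g x) * Re (g x) + Im (g x) * Im (g x).
have Cq : rsmooth A (fun x => (q x)^-1).
  apply: rsmoothV => //; last by apply: rsmoothD => //; exact: rsmoothM.
  move=> x /g0; rewrite /q; case: (g x) => a b /=; apply: contra_neq => /eqP.
  by rewrite -!expr2 paddr_eq0 ?sqr_ge0// !sqrf_eq0 => /andP[/eqP-> /eqP->].
split.
  apply: rsmooth_ext (rsmoothM chX oA gr Cq) => // x _.
  by rewrite /q; case: (g x) => a b; rewrite /= -!expr2.
apply: rsmooth_ext (rsmoothN chX oA (rsmoothM chX oA gi Cq)) => // x _.
by rewrite /q; case: (g x) => a b; rewrite /= -!expr2.
Qed.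

Lemma csmooth_sum I (s : seq I) (P : pred I) (g : I -> X -> C) : (forall i, csmooth (g i)) ->
  csmooth (fun x => \sum_(i <- s | P i) g i x).
Proof.
move=> Cg; elim: s => [|i s IH].
  by apply: csmooth_ext (csmooth_cst 0) => x _; rewrite big_nil.
case Pi : (P i).
  by apply: csmooth_ext (csmoothD (Cg i) IH) => x _; rewrite big_cons Pi.
by apply: csmooth_ext IH => x _; rewrite big_cons Pi.
Qed.

Lemma csmooth_prod I (s : seq I) (g : I -> X -> C) : (forall i, csmooth (g i)) ->
  csmooth (fun x => \prod_(i <- s) g i x).
Proof.
move=> Cg; elim: s => [|i s IH].
  by apply: csmooth_ext (csmooth_cst 1) => x _; rewrite big_nil.
by apply: csmooth_ext (csmoothM (Cg i) IH) => x _; rewrite big_cons.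
Qed.

Definition mxsmooth a b (F : X -> 'M[C]_(a, b)) : Prop :=
  forall i j, csmooth (fun x => F x i j).

Lemma mxsmooth_ext a b (F G : X -> 'M[C]_(a, b)) : (forall x, A x -> F x = G x) ->
  mxsmooth F -> mxsmooth G.
Proof. by move=> FG CF i j; apply: csmooth_ext (CF i j) => x /FG ->. Qed.

Lemma mxsmooth_mul a b c (F : X -> 'M[C]_(a, b)) (G : X -> 'M[C]_(b, c)) :
  mxsmooth F -> mxsmooth G -> mxsmooth (fun x => F x *m G x).
Proof.
move=> CF CG i j; have Cs k : csmooth (fun x => F x i k * G x k j) by exact: csmoothM.
by apply: csmooth_ext (csmooth_sum (index_enum 'I_b) xpredT Cs) => x _; rewrite mxE.
Qed.

(** The determinant unfolds to the Leibniz sum of signed products of entries. *)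
Lemma csmooth_det n (F : X -> 'M[C]_n) : mxsmooth F -> csmooth (fun x => \det (F x)).
Proof.
move=> CF; apply: csmooth_sum => s; apply: csmoothM; first exact: csmooth_cst.
exact: csmooth_prod.
Qed.

(** Cramer's rule: the entries of the adjugate are signed minors, that is, determinants of smooth
    matrices, and the determinant does not vanish on [A]. *)
Lemma mxsmooth_inv n (F : X -> 'M[C]_n) : (forall x, A x -> F x \in unitmx) ->
  mxsmooth F -> mxsmooth (fun x => invmx (F x)).
Proof.
move=> uF CF.
apply: (@mxsmooth_ext _ _ (fun x => (\det (F x))^-1 *: \adj (F x))).
  by move=> x /uF; rewrite /invmx => ->.
move=> i j; apply: (@csmooth_ext (fun x => (\det (F x))^-1 *
    ((-1) ^+ (j + i) * \det (row' j (col' i (F x)))))).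
  by move=> x _; rewrite !mxE.
apply: csmoothM; first apply: csmoothV; last 2 first.
- exact: csmooth_det.
- apply: csmoothM; first exact: csmooth_cst.
  by apply: csmooth_det => k l; apply: csmooth_ext (CF (lift j k) (lift i l)) => x _; rewrite !mxE.
- by move=> x /uF; rewrite unitmxE unitfE.
Qed.

Lemma mxsmooth_coord a b (F : X -> 'M[C]_(a, b)) :
  mxsmooth F <-> forall k, rsmooth A (fun x => mx_coord (F x) 0 k).
Proof.
split=> [CF k|CF i j].
  case: (split_ordP k) => l ->; case/mxvec_indexP: l => i j.
    by apply: rsmooth_ext (CF i j).1 => // x _; rewrite row_mxEl mxvecE mxE.
  by apply: rsmooth_ext (CF i j).2 => // x _; rewrite row_mxEr mxvecE mxE.
split.
  by apply: rsmooth_ext (CF (lshift _ (mxvec_index i j))) => // x _; rewrite row_mxEl mxvecE mxE.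
by apply: rsmooth_ext (CF (rshift _ (mxvec_index i j))) => // x _; rewrite row_mxEr mxvecE mxE.
Qed.

End SmoothComplex.

Lemma mxsmooth_comp (X Y : space_with_charts R) a b (A : set X) (B : set Y) (f : X -> Y)
  (F : Y -> 'M[C]_(a, b)) :
  charted X -> charted Y -> open A -> open B -> smooth_on A f ->
  (forall x, A x -> B (f x)) -> mxsmooth B F -> mxsmooth A (fun x => F (f x)).
Proof.
move=> chX chY oA oB sf AB CF i j; have [Cr Ci] := CF i j; split.
  exact: (rsmooth_comp chX chY oA oB sf AB Cr).
exact: (rsmooth_comp chX chY oA oB sf AB Ci).
Qed.

(** * Matrix spaces and GL(r,C) as spaces with one global chart *)

Lemma mx_coordK a b : cancel (@mx_coord R a b) (@mx_of_coord R a b).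
Proof.
move=> F; apply/matrixP => i j.
by rewrite mxE row_mxKl row_mxKr !mxvecK !mxE; case: (F i j).
Qed.

Lemma mx_of_coordK a b : cancel (@mx_of_coord R a b) (@mx_coord R a b).
Proof.
move=> w; rewrite -[RHS]hsubmxK /mx_coord -[lsubmx w]vec_mxK -[rsubmx w]vec_mxK.
by congr row_mx; congr mxvec; apply/matrixP => i j; rewrite !mxE.
Qed.

(** For one row this is [Cr_space] up to conversion, so both share the lemmas below. *)
Definition Mat_space a b : space_with_charts R :=
  coord_space (@mx_coord R a b) (@mx_of_coord R a b).

Lemma range_mx_coord a b : range (@mx_coord R a b) = setT.
Proof. by apply/seteqP; split=> // w _; exists (mx_of_coord w) => //; rewrite mx_of_coordK. Qed.

Lemma Mat_charted a b : charted (Mat_space a b).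
Proof.
by apply: coord_charted; [exact: mx_coordK|rewrite range_mx_coord; exact: openT].
Qed.

Lemma Mat_compatible a b : compatible (Mat_space a b).
Proof.
by apply: coord_compatible; [exact: mx_coordK|rewrite range_mx_coord; exact: openT].
Qed.

Lemma smooth_on_Mat (X : space_with_charts R) (A : set X) a b (F : X -> Mat_space a b) :
  charted X -> open A -> smooth_on A F <-> mxsmooth A (F : X -> 'M[C]_(a, b)).
Proof.
move=> chX oA; apply: iff_trans (iff_sym (mxsmooth_coord chX oA _)).
by apply: smooth_on_coord => //; [exact: mx_coordK|rewrite range_mx_coord; exact: openT].
Qed.

Lemma mxsmooth_id a b (A : set (Mat_space a b)) : open A -> mxsmooth A (fun F => F).
Proof.
move=> oA; apply/smooth_on_Mat => //; first exact: Mat_charted.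
by apply: smooth_on_id => //; [exact: Mat_charted|exact: Mat_compatible].
Qed.

Lemma GL_coordK r : cancel (fun F : GL R r => mx_coord (val F))
  (fun w => insubd (GL_one R r) (mx_of_coord w)).
Proof. by move=> F; rewrite mx_coordK valKd. Qed.

Lemma range_GL_coord r : range (fun F : GL R r => mx_coord (val F)) =
  [set w | mx_of_coord w \in unitmx].
Proof.
apply/seteqP; split=> [_ [F _ <-]|w uw]; first by rewrite /= mx_coordK; exact: (valP F).
by exists (Sub (mx_of_coord w) uw) => //; rewrite SubK mx_of_coordK.
Qed.

Lemma open_GL_coord r : open (range (fun F : GL R r => mx_coord (val F))).
Proof.
have chM := Mat_charted r r; have oT := @openT (Mat_space r r).
have [Cr Ci] := csmooth_det chM oT (mxsmooth_id oT).
(* Order 0 of smoothness, read in the only chart of the matrix space. *)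
have cr (g : 'M[C]_r -> R) : rsmooth (setT : set (Mat_space r r)) g ->
    continuous (fun w => g (mx_of_coord w)).
  move=> Cg w; apply: (Cg _ erefl 0%N).
  by exists (mx_of_coord w); [split|exact: mx_of_coordK].
rewrite range_GL_coord (_ : [set w | _] =
  ((fun w => Re (\det (@mx_of_coord R r r w))) @^-1` [set~ 0]) `|`
  ((fun w => Im (\det (@mx_of_coord R r r w))) @^-1` [set~ 0])).
  have o0 : open [set~ (0 : R)].
    by rewrite openC; exact: accessible_closed_set1 (hausdorff_accessible (@Rhausdorff R)) _.
  by apply: openU; apply: open_comp => // w _; [exact: (cr _ Cr)|exact: (cr _ Ci)].
apply/seteqP; split=> w /=; rewrite unitmxE unitfE; case: (\det _) => a b.
  rewrite eq_complex /= negb_and => /orP[/eqP|/eqP]; [by left|by right].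
by rewrite eq_complex /= negb_and => -[/eqP->|/eqP->]; rewrite ?orbT.
Qed.

Lemma GL_charted r : charted (GL_space R r).
Proof. by apply: coord_charted; [exact: GL_coordK|exact: open_GL_coord]. Qed.

Lemma GL_compatible r : compatible (GL_space R r).
Proof. by apply: coord_compatible; [exact: GL_coordK|exact: open_GL_coord]. Qed.

Lemma smooth_on_GL (X : space_with_charts R) (A : set X) r (F : X -> GL_space R r) :
  charted X -> open A -> smooth_on A F <-> mxsmooth A (fun x => val (F x : GL R r)).
Proof.
move=> chX oA; apply: iff_trans (iff_sym (mxsmooth_coord chX oA _)).
by apply: smooth_on_coord => //; [exact: GL_coordK|exact: open_GL_coord].
Qed.

Lemma mxsmooth_val r (A : set (GL_space R r)) : open A -> mxsmooth A (fun F => val (F : GL R r)).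
Proof.
move=> oA; apply/smooth_on_GL => //; first exact: GL_charted.
by apply: smooth_on_id => //; [exact: GL_charted|exact: GL_compatible].
Qed.

End ComplexMatrices.

(** * The topology of GL(r,C) *)

Section GLTopology.
Variable R : realType.
Local Notation C := R[i].

Lemma injective_hausdorff (S T : topologicalType) (f : S -> T) :
  continuous f -> injective f -> hausdorff_space T -> hausdorff_space S.
Proof.
move=> cf fI hT p q pq; apply/fI/hT => A B Ap Bq.
have [x [Ax Bx]] := pq _ _ (cf _ _ Ap) (cf _ _ Bq).
by exists (f x).
Qed.

Lemma initial_second_countable (S : choiceType) (T : topologicalType) (f : S -> T) :
  @second_countable T -> @second_countable (initial_topology f).
Proof.
move=> [B cB [oB bB]].
exists ((fun O : set T => (f @^-1` O : set (initial_topology f))) @` B).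
  exact: sub_countable (card_image_le _ _) cB.
split=> [_ [W BW <-]|x U [_ [[W oW <-] Wfx] WU]].
  have oW := oB _ BW.
  by apply: open_comp => // y _; exact: initial_continuous.
have [V [BV Vfx] VW] := bB (f x) W (open_nbhs_nbhs (conj oW Wfx)).
exists (f @^-1` V); first by split=> //; exists V.
by move=> y /VW/WU.
Qed.

Lemma rV_second_countable n : @second_countable 'rV[R]_n.
Proof.
(* Boxes with rational corners form a countable base. *)
pose box (ab : 'rV[rat]_n * 'rV[rat]_n) := [set w : 'rV[R]_n |
  forall j, ratr (ab.1 0 j) < w 0 j < ratr (ab.2 0 j)].
exists (range box); first exact: sub_countable (card_image_le _ _) (countableP _).
split=> [_ [[a b] _ <-]|x U /nbhs_ballP[e /= e0 xeU]].
  rewrite openE => w abw; apply: (@filter_forall _ _ _ _ (nbhs_filter w)) => j.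
  have oI : open (`](ratr (a 0 j) : R), ratr (b 0 j)[%classic : set R) by exact: interval_open.
  have wI : `](ratr (a 0 j) : R), ratr (b 0 j)[%classic (w 0 j) by rewrite /= in_itv /=; exact: abw.
  have H : nbhs w ((fun y : 'rV[R]_n => y 0 j) @^-1` `](ratr (a 0 j) : R), ratr (b 0 j)[%classic).
    exact: coord_continuous (open_nbhs_nbhs (conj oI wI)).
  by apply: (@filterS _ _ (nbhs_filter w) _ _ _ H) => y; rewrite /= in_itv.
have /choice[a aP] j : exists q : rat, x 0 j - e < ratr q < x 0 j.
  have /rat_in_itvoo[q] : x 0 j - e < x 0 j by rewrite ltrBlDr ltrDl.
  by rewrite in_itv; exists q.
have /choice[b bP] j : exists q : rat, x 0 j < ratr q < x 0 j + e.
  have /rat_in_itvoo[q] : x 0 j < x 0 j + e by rewrite ltrDl.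
  by rewrite in_itv; exists q.
exists (box (\row_j a j, \row_j b j)).
  split=> [|j]; first by exists (\row_j a j, \row_j b j).
  by rewrite !mxE; case/andP: (aP j) => _ ->; case/andP: (bP j) => ->.
move=> y /= yb; apply: xeU; split=> // i j; rewrite (ord1 i).
have := yb j; rewrite !mxE => /andP[ay yb'].
have /andP[ax _] := aP j; have /andP[_ xb] := bP j.
rewrite /ball /= ltr_distlC; apply/andP; split; first exact: lt_trans ax ay.
exact: lt_trans yb' xb.
Qed.

Lemma GL_hausdorff r : hausdorff_space (GL_space R r).
Proof.
apply: (@injective_hausdorff (GL_space R r) _ (fun F : GL R r => mx_coord (val F))).
- exact: initial_continuous.
- exact: can_inj (@GL_coordK R r).
- exact: norm_hausdorff.
Qed.

Lemma GL_second_countable r : @second_countable (GL_space R r).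
Proof. exact/initial_second_countable/rV_second_countable. Qed.

(** Evaluation commutes with the determinant, so [p] is the determinant of a matrix of polynomials;
    it is nonzero because its value at 0 is det 1 = 1. *)
Lemma det_segment_poly r (F : 'M[C]_r) :
  {p : {poly C} | p != 0 & forall z, p.[z] = \det ((1 - z)%:M + z *: F)}.
Proof.
pose Q : 'M[{poly C}]_r := (1 - 'X)%:M + 'X *: map_mx polyC F.
have QE z : (\det Q).[z] = \det ((1 - z)%:M + z *: F).
  rewrite -[LHS]/(horner_eval z _) -det_map_mx; congr (\det _).
  apply/matrixP => i j; rewrite mxE /horner_eval /Q !mxE.
  by case: (i == j); rewrite /= ?mulr1n ?mulr0n /horner_eval ?hornerE.
exists (\det Q); last exact: QE.
apply/eqP => Q0; have := QE 0.
by rewrite Q0 horner0 subr0 scale0r addr0 det1 => /eqP; rewrite eq_sym oner_eq0.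
Qed.

(* The paths t + i s t(1-t) from 0 to 1, for distinct s, meet only at their ends,
   so one of them avoids the finitely many zeros of det ((1-z) + z F). *)
Lemma nonsingular_path r (F : 'M[C]_r) : F \in unitmx ->
  exists s : R, forall t : R, 0 <= t <= 1 ->
    (1 - (t +i* (s * (t * (1 - t)))))%:M + (t +i* (s * (t * (1 - t)))) *: F \in unitmx.
Proof.
move=> uF; have [p p0 pE] := det_segment_poly F.
pose g (s t : R) : C := t +i* (s * (t * (1 - t))).
have pg s t : ((1 - g s t)%:M + g s t *: F \in unitmx) = ~~ root p (g s t).
  by rewrite unitmxE unitfE -pE.
apply: contrapT => /forallNP bad.
have /choice[t tP] (s : nat) : exists t : R, 0 < t < 1 /\ root p (g s%:R t).
  have /existsNP[t /not_implyP[/andP[t0 t1] /negP]] := bad s%:R.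
  rewrite -/(g _ _) pg negbK => rt; exists t; split=> //.
  (* The ends are excluded: [p] takes there the nonzero values det 1 and det F. *)
  rewrite !lt_neqAle t0 t1 !andbT; apply/andP; split; apply/eqP => tE; move: rt.
    rewrite -tE (_ : g _ _ = 0); last by rewrite /g mul0r mulr0.
    by apply/negP; rewrite /root pE subr0 scale0r addr0 det1 oner_neq0.
  rewrite tE (_ : g _ _ = 1); last by rewrite /g subrr !mulr0.
  apply/negP; rewrite /root pE subrr scale1r -scalemx1 scale0r add0r.
  by rewrite -unitfE -unitmxE.
(* The parameters 0, ..., size p - 1 supply size p distinct roots, one more than a nonzero [p] can
   have. Equal points have equal real part t, and t(1-t) is nonzero, so their parameters agree. *)
pose zs := [seq g s%:R (t s) | s <- iota 0 (size p)].
have : (size zs < size p)%N.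
  apply: max_poly_roots => //; first by apply/allP => _ /mapP[s _ ->]; case: (tP s).
  rewrite map_inj_uniq ?iota_uniq// => a b [tab].
  have [/andP[t0 t1] _] := tP a; rewrite -tab => /mulIf H.
  by apply/eqP; rewrite -(eqr_nat R); apply/eqP/H; rewrite mulf_neq0 ?gt_eqF// subr_gt0.
by rewrite size_map size_iota ltnn.
Qed.

Lemma GL_connected r : connected [set: GL_space R r].
Proof.
have H (F : GL R r) : exists A : set (GL_space R r),
    [/\ connected A, A (GL_one R r) & A F].
  have [s sP] := nonsingular_path (valP F).
  pose z (t : R) : C := t +i* (s * (t * (1 - t))).
  pose G (t : R) : 'M[C]_r := (1 - z t)%:M + z t *: val F.
  (* The default value is used at most outside [0, 1], where [G t] may be singular. *)
  pose g (t : R) : GL_space R r := insubd (GL_one R r) (G t).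
  have gE t : 0 <= t <= 1 -> val (g t : GL R r) = G t.
    by move=> /sP uG; rewrite /g val_insubd uG.
  exists (g @` `[0, 1]); split.
  - apply: connected_continuous_connected; first exact: segment_connected.
    have cG : continuous (fun t => mx_coord (G t)).
      move=> t; apply: rV_continuous => j.
      have cabc a b c : continuous (fun t : R => a + b * t + c * (t * (1 - t))).
        move=> u; apply: cvgD; first apply: cvgD; [exact: cvg_cst| |];
          apply: cvgM; [exact: cvg_cst|exact: cvg_id|exact: cvg_cst|apply: cvgM];
          [exact: cvg_id|apply: cvgB; [exact: cvg_cst|exact: cvg_id]].
      (* An entry of [G t] is e + z (F i k - e), with e the Kronecker symbol and z = t + i s t(1-t).
         Its real and imaginary parts give the coefficients a, b, c. *)
      suff [a [b [c E]]] :
          exists a b c, forall t, mx_coord (G t) 0 j = a + b * t + c * (t * (1 - t)).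
        by rewrite (funext E); exact: cabc.
      case: (split_ordP j) => k ->; case/mxvec_indexP: k => i k.
        pose e : R := (i == k)%:R.
        exists e, (complex.Re (val F i k) - e), (- (s * complex.Im (val F i k))) => u.
        rewrite row_mxEl mxvecE !mxE /e.
        by case: (i == k); case: (val F i k) => a b /=; rewrite ?mulr1n ?mulr0n /=; ring.
      pose e : R := (i == k)%:R.
      exists 0, (complex.Im (val F i k)), (s * complex.Re (val F i k) - s * e) => u.
      rewrite row_mxEr mxvecE !mxE /e.
      by case: (i == k); case: (val F i k) => a b /=; rewrite ?mulr1n ?mulr0n /=; ring.
    move=> t; apply: initial_continuous_for; move: t.
    apply: (@subspace_eq_continuous _ _ _ (fun t => mx_coord (G t))).
      by move=> t; rewrite inE /= in_itv /= => /gE ->.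
    exact: continuous_subspaceT.
  - exists 0; first by rewrite /= in_itv /= lexx ler01.
    apply: val_inj; rewrite gE ?lexx ?ler01// /G (_ : z 0 = 0).
      by rewrite subr0 scale0r addr0.
    by rewrite /z mul0r mulr0.
  - exists 1; first by rewrite /= in_itv /= lexx ler01.
    apply: val_inj; rewrite gE ?lexx ?ler01// /G (_ : z 1 = 1).
      by rewrite subrr scale1r -scalemx1 scale0r add0r.
    by rewrite /z subrr !mulr0.
have /choice[A AP] := H.
rewrite (_ : setT = \bigcup_(F in setT) A F).
  apply: bigcup_connected; last by move=> F _; case: (AP F).
  by exists (GL_one R r) => F _; case: (AP F).
by apply/seteqP; split=> // F _; exists F => //; case: (AP F).
Qed.

End GLTopology.

(** * Gluing a fibre bundle from a cocycle *)

(* The fibres of the bundle to be glued are identified with [F] in an arbitrary,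
   possibly discontinuous way; [ctriv i x] is the [i]-th trivialization over [x]
   read through this identification, with inverse [cinv i x]. *)
Record cocycle (R : realType) (M : manifold R) (F : space_with_charts R) := Cocycle {
  cindex : Type;
  cdom : cindex -> set M;
  ctriv : cindex -> M -> F -> F;
  cinv : cindex -> M -> F -> F;
  cdom_open : forall i, open (cdom i);
  cdom_cover : forall x, exists i, cdom i x;
  ctrivK : forall i x, cancel (ctriv i x) (cinv i x);
  cinvK : forall i x, cancel (cinv i x) (ctriv i x);
  ctrans_smooth : forall i j,
    smooth_on ((cdom i `&` cdom j) `*` setT : set (prod_space M F))
      ((fun z => (z.1, ctriv j z.1 (cinv i z.1 z.2))) : prod_space M F -> prod_space M F) }.

Section Gluing.
Variables (R : realType) (M : manifold R) (F : space_with_charts R).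

(** An alias indexed by the cocycle, so that this set carries the glued topology and not the product
    one. *)
Definition glued (G : cocycle M F) : Type := (M * F)%type.

HB.instance Definition _ (G : cocycle M F) := Choice.copy (glued G) (M * F)%type.

Section GluedTopology.
Variable G : cocycle M F.
Local Notation I := (cindex G).
Local Notation W := (@cdom _ _ _ G).
Local Notation P := (prod_space M F).

Definition gproj (e : glued G) : M := e.1.
Definition gtriv (i : I) (e : glued G) : P := (e.1, ctriv i e.1 e.2).
Definition ginv (i : I) (z : P) : glued G := (z.1, cinv i z.1 z.2).

Lemma gtrivK i : cancel (gtriv i) (ginv i).
Proof. by move=> [x a]; rewrite /ginv /= ctrivK. Qed.

Lemma ginvK i : cancel (ginv i) (gtriv i).
Proof. by move=> [x a]; rewrite /gtriv /= cinvK. Qed.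

(** The finest topology that makes every [ginv i] continuous over [W i]. *)
Definition glued_open (O : set (glued G)) : Prop :=
  forall i, open ((W i `*` setT) `&` ginv i @^-1` O : set P).

Lemma open_cylinder (A : set M) : open A -> open (A `*` setT : set P).
Proof. by move=> oA; exact: open_setX oA openT. Qed.

Let glued_openT : glued_open setT.
Proof. by move=> i; rewrite preimage_setT setIT; exact/open_cylinder/cdom_open. Qed.

Let glued_openI : setI_closed glued_open.
Proof.
move=> A B oA oB i; rewrite preimage_setI (_ : _ `&` _ =
  ((W i `*` setT) `&` ginv i @^-1` A) `&` ((W i `*` setT) `&` ginv i @^-1` B)).
  exact: openI.
by rewrite setIACA setIid.
Qed.

Let glued_open_bigU (J : Type) (f : J -> set (glued G)) :
  (forall j, glued_open (f j)) -> glued_open (\bigcup_j f j).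
Proof.
move=> of_ i; rewrite preimage_bigcup setI_bigcupr.
by apply: bigcup_open => j _; exact: of_.
Qed.

HB.instance Definition _ :=
  @isOpenTopological.Build (glued G) glued_open glued_openT glued_openI glued_open_bigU.

End GluedTopology.

Variable G : cocycle M F.
Hypotheses (chF : charted F) (hF : hausdorff_space F) (scF : @second_countable F)
  (cnF : connected [set: F]) (a0 : F).
Local Notation I := (cindex G).
Local Notation W := (@cdom _ _ _ G).
Local Notation P := (prod_space M F).
Local Notation q := (@gproj G).

Let chM : charted M := manifold_charted M.
Let chP : charted P := prod_charted chM chF.

Lemma ctrans_continuous i j z : W i z.1 -> W j z.1 ->
  {for z, continuous (fun z : P => gtriv j (ginv i z) : P)}.
Proof. by move=> Wi Wj; have [+ _] := ctrans_smooth i j; apply. Qed.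

Lemma ginv_continuous i (z : P) : W i z.1 -> {for z, continuous (ginv i)}.
Proof.
move=> Wi V [N0 [oN0 N0z N0V]]; have oi := oN0 i.
have : nbhs z ((W i `*` setT) `&` ginv i @^-1` N0) by apply: open_nbhs_nbhs; split.
by apply: filterS => y [_ /N0V].
Qed.

(** Read through [ginv j], the map [gtriv i] is a transition map of the cocycle, continuous over the
    overlap of [W i] and [W j]. *)
Lemma gtriv_continuous i (e : glued G) : W i (q e) -> {for e, continuous (gtriv i)}.
Proof.
move=> Wi V; rewrite nbhsE => -[N0 [oN0 N0e] N0V].
have oS : open [set e' | W i (q e') /\ N0 (gtriv i e')]; last first.
  have : nbhs e [set e' | W i (q e') /\ N0 (gtriv i e')] by exact: open_nbhs_nbhs.
  by apply: filterS => e' [_ /N0V].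
suff : glued_open [set e' | W i (q e') /\ N0 (gtriv i e')] by [].
move=> j; rewrite (_ : _ `&` _ = ((W j `&` W i) `*` setT) `&`
    (fun z : P => gtriv i (ginv j z)) @^-1` N0).
  apply: open_setI_preimage => //; first by apply/open_cylinder/openI; exact: cdom_open.
  by move=> z [[Wj Wi'] _]; exact: ctrans_continuous.
by apply/seteqP; split=> [z [[Wj _] [Wi' N0z]]|z [[[Wj Wi'] _] N0z]].
Qed.

Lemma open_gproj (A : set M) : open A -> open (q @^-1` A).
Proof.
move=> oA; suff : glued_open (q @^-1` A) by [].
move=> i; rewrite (_ : _ `&` _ = (W i `&` A) `*` setT).
  by apply/open_cylinder/openI => //; exact: cdom_open.
by apply/seteqP; split=> [z [[Wi _] Az]|z [[Wi Az] _]].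
Qed.

Lemma gproj_continuous : continuous q.
Proof. by apply/continuousP => A oA; exact: open_gproj. Qed.

(** Points that cannot be separated have the same base point because M is Hausdorff, and then the
    same coordinate in one trivialization because F is. *)
Lemma glued_hausdorff : hausdorff_space (glued G).
Proof.
move=> e e' ee'; have hM : hausdorff_space M by case: (manifoldP M).
have E1 : q e = q e'.
  apply: hM => A B /(@gproj_continuous e) Ae /(@gproj_continuous e') Be.
  by have [x [Ax Bx]] := ee' _ _ Ae Be; exists (q x).
have [i Wi] := cdom_cover G (q e); have Wi' : W i (q e') by rewrite -E1.
have E2 : (gtriv i e).2 = (gtriv i e').2.
  apply: hF => A B Ae Be.
  have := ee' _ _ (gtriv_continuous Wi (@snd_continuous M F _ _ Ae))
                 (gtriv_continuous Wi' (@snd_continuous M F _ _ Be)).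
  by move=> [x [Ax Bx]]; exists (gtriv i x).2.
suff E : gtriv i e = gtriv i e' by rewrite -(gtrivK i e) E gtrivK.
exact: injective_projections.
Qed.

(** To keep the base countable, one index i is selected for each basic open [N] contained in some
    [W i]. The second basic set [N'] shrinks the base without changing this index: a smaller [N]
    could select another trivialization. *)
Lemma glued_second_countable : @second_countable (glued G).
Proof.
have [_ [BM cBM [oBM bBM]] _ _ _] := manifoldP M; have [BF cBF [oBF bBF]] := scF.
pose f N N' K : set (glued G) := match pselect (exists i, N `<=` W i) with
  | left h => [set e | N (q e) /\ N' (q e) /\ K (gtriv (projT1 (cid h)) e).2]
  | right _ => set0 end.
exists (\bigcup_(N in BM) \bigcup_(N' in BM) (f N N' @` BF)).
  apply: bigcup_countable => // N _; apply: bigcup_countable => // N' _.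
  exact: sub_countable (card_image_le _ _) cBF.
split=> [_ [N BN [N' BN' [K BK <-]]]|e U].
  rewrite /f; case: pselect => [h|_]; last exact: open0.
  case: (cid h) => i /= NW.
  have oN : open (q @^-1` N) by apply: open_gproj; exact: oBM.
  have oN' : open (q @^-1` N') by apply: open_gproj; exact: oBM.
  have := open_setI_preimage oN _ (oBF _ BK) => /(_ (fun e => (gtriv i e).2)) H.
  have oK : open (q @^-1` N `&` (fun e => (gtriv i e).2) @^-1` K).
    apply: H => e Ne; apply: (@continuous_comp _ _ _ (gtriv i) snd).
      by apply: gtriv_continuous; exact: NW.
    exact: snd_continuous.
  have := openI oN' oK; congr open; apply/seteqP.
  by split=> [x [? [? ?]]|x [? [? ?]]].
rewrite nbhsE => -[N0 [oN0 N0e] N0U].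
have [j Wj] := cdom_cover G (q e).
have [N [BN Ne] NW] := bBM (q e) (W j) (open_nbhs_nbhs (conj (cdom_open j) Wj)).
have h : exists i, N `<=` W i by exists j.
have [i iP Ni] : exists2 i, i = projT1 (cid h) & N `<=` W i.
  by exists (projT1 (cid h)) => //; exact: (projT2 (cid h)).
have oi : nbhs (gtriv i e) ((W i `*` setT) `&` ginv i @^-1` N0).
  apply: open_nbhs_nbhs; split; first exact: (oN0 i).
  by split; [split=> //; exact: Ni|rewrite /= gtrivK].
have [[A B] [/= Ae Be] AB] := oi.
have [N' [BN' N'e] N'A] := bBM _ _ Ae; have [K [BK Ke] KB] := bBF _ _ Be.
have fE : f N N' K = [set e | N (q e) /\ N' (q e) /\ K (gtriv i e).2].
  rewrite /f; case: pselect => [h'|/(_ h)//].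
  (* The selected index depends on the proof passed to [cid]; irrelevance makes both selections
     agree. *)
  by rewrite (_ : h' = h) ?iP//; exact: Prop_irrelevance.
exists (f N N' K); first by split; [exists N => //; exists N' => //; exists K|rewrite fE].
rewrite fE => x [Nx [N'x Kx]]; apply: N0U; rewrite -(gtrivK i x).
by have [] := AB (gtriv i x) (conj (N'A _ N'x) (KB _ Kx)).
Qed.

(** A clopen set is a union of fibres since F is connected. As the projection is open, the images of
    the set and of its complement are open; being complementary, they force the first to be all of
    M. *)
Lemma glued_connected : connected [set: glued G].
Proof.
move=> B [e0 Be0] [N0 oN0]; rewrite setTI => BO; subst N0 => -[D cD]; rewrite setTI => BD; subst D.
have oC : open (~` B) by rewrite openC.
have sat (D : set (glued G)) : open D -> open (~` D) -> forall e e', q e = q e' -> D e -> D e'.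
  move=> oD oCD [x a] [_ b] /= <- Da; have [i Wi] := cdom_cover G x.
  have cj : continuous (fun c : F => ginv i (x, c)).
    move=> c; apply: (@continuous_comp _ _ _ (fun c : F => (x, c) : P) (ginv i)).
      by apply: pair_continuous => //; exact: cvg_cst.
    exact: ginv_continuous.
  have oS : open [set c | D (ginv i (x, c))] by apply: open_comp oD => c _; exact: cj.
  have cS : closed [set c | D (ginv i (x, c))].
    rewrite -openC; have : open [set c | (~` D) (ginv i (x, c))]
      by apply: open_comp oCD => c _; exact: cj.
    by [].
  have E : [set c | D (ginv i (x, c))] = setT.
    apply: cnF.
    - by exists (ctriv i x a); rewrite /= -[(x, ctriv i x a)]/(gtriv i (x, a)) gtrivK.
    - by exists [set c | D (ginv i (x, c))]; rewrite ?setTI.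
    - by exists [set c | D (ginv i (x, c))]; rewrite ?setTI.
  have : [set: F] (ctriv i x b) by [].
  by rewrite -E /= -[(x, ctriv i x b)]/(gtriv i (x, b)) gtrivK.
have op (D : set (glued G)) : open D -> open (q @` D).
  move=> oD; rewrite openE => _ [e De <-]; have [i Wi] := cdom_cover G (q e).
  have oi : open ((W i `*` setT) `&` ginv i @^-1` D) by exact: (oD i).
  have : nbhs (q e) (fst @` ((W i `*` setT) `&` ginv i @^-1` D)).
    apply: open_nbhs_nbhs; split; first exact: fst_open.
    by exists (gtriv i e) => //; split=> //; rewrite /= gtrivK.
  by apply: filterS => _ [z [_ Dz] <-]; exists (ginv i z).
have cM : connected [set: M] by case: (manifoldP M).
have BCE : ~` (q @` B) = q @` (~` B).
  apply/seteqP; split=> [x nB|_ [e nBe <-] [e' Be' ee']].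
    (* The point [a0] of F shows that no fibre is empty. *)
    by exists ((x, a0) : glued G) => // Bx; apply: nB; exists (x, a0).
  exact/nBe/(sat _ oN0 oC _ _ ee' Be').
have E : q @` B = setT.
  apply: cM.
  - by exists (q e0); exists e0.
  - by exists (q @` B); rewrite ?setTI; [exact: op|].
  - by exists (q @` B); rewrite ?setTI// -openC BCE; exact: op.
apply/seteqP; split=> // e _.
have [e' Be' ee'] : (q @` B) (q e) by rewrite E.
exact: (sat _ oN0 oC _ _ ee' Be').
Qed.

(** * The atlas of the glued space and its local triviality *)

Definition gchart (i : I) (p : chart R P (dimension P)) : chart R (glued G) (dimension P) :=
  Chart (q @^-1` W i `&` gtriv i @^-1` chart_dom p)
        (fun e => chart_fun p (gtriv i e))
        (fun w => ginv i (chart_inv p w)).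

Definition glued_space : space_with_charts R :=
  @SpaceWithCharts R (glued G) (dimension P)
    [set e | exists i p, @atlas R P p /\ e = gchart i p].

Lemma gchart_is_chart i p : @atlas R P p -> is_chart (gchart i p).
Proof.
move=> ap; have ip := chP.1 p ap; have [op oI pK cp ci] := ip.
have oW := open_cylinder (cdom_open i).
have imgE : chart_img (gchart i p) = chart_fun p @` ((W i `*` setT) `&` chart_dom p).
  apply/seteqP; split=> [_ [e [We pe] <-]|_ [z [[Wz _] pz] <-]].
    by exists (gtriv i e).
  by exists (ginv i z); rewrite /= ?ginvK //; split; rewrite /= ?ginvK.
split.
- apply: open_setI_preimage => //; first by apply: open_gproj; exact: cdom_open.
  by move=> e We; exact: gtriv_continuous.
- by rewrite imgE; exact: open_chart_image.
- by move=> e [We pe] /=; rewrite pK// gtrivK.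
- move=> e [We pe]; apply: (@continuous_comp _ _ _ (gtriv i) (chart_fun p)).
    exact: gtriv_continuous.
  exact: cp.
- rewrite imgE => _ [z [[Wz _] pz] <-].
  apply: (@continuous_comp _ _ _ (chart_inv p) (ginv i)).
    by apply: ci; exists z.
  by rewrite pK//; exact: ginv_continuous.
Qed.

Lemma glued_charted : charted glued_space.
Proof.
split=> [_ [i [p [ap ->]]]|e]; first exact: gchart_is_chart.
have [i Wi] := cdom_cover G (q e); have [p ap pe] := chP.2 (gtriv i e).
by exists (gchart i p) => //; exists i, p.
Qed.

(** One coordinate expression serves for the chart changes and for the smoothness of [gtriv] and
    [ginv]; only the description of its domain varies. *)
Lemma gchart_trans i j p p' : @atlas R P p -> @atlas R P p' ->
  Cinf_on (chart_fun p @` [set z | W i z.1 /\ W j z.1 /\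
             chart_dom p z /\ chart_dom p' (gtriv j (ginv i z))])
    (fun w => chart_fun p' (gtriv j (ginv i (chart_inv p w)))).
Proof.
move=> ap ap'; have [_ /(_ p p' ap ap')] := ctrans_smooth i j.
congr Cinf_on; congr image; apply/seteqP.
by split=> [z [[[[? ?] _] ?] ?]|z [? [? [? ?]]]].
Qed.

Lemma glued_is_manifold : is_manifold glued_space.
Proof.
split.
- exact: glued_hausdorff.
- exact: glued_second_countable.
- exact: glued_connected.
- exact: glued_charted.
- move=> _ _ [i [p [ap ->]]] [j [p' [ap' ->]]].
  have := gchart_trans i j ap ap'; congr Cinf_on; apply/seteqP.
  split=> [_ [z [? [? [? ?]]] <-]|_ [e [[We pe] [We' pe']] <-]].
    by exists (ginv i z); rewrite /= ?ginvK//; split; split; rewrite /= ?ginvK.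
  by exists (gtriv i e) => //; split=> //; split=> //; split=> //; rewrite gtrivK.
Qed.

Definition glued_manifold : manifold R := Manifold glued_is_manifold.
Definition gmap (e : glued_manifold) : M := q e.

Lemma smooth_on_gtriv i :
  smooth_on (gmap @^-1` W i) (gtriv i : glued_manifold -> P).
Proof.
split=> [e We|_ p' [j [p [ap ->]]] ap']; first exact: gtriv_continuous.
have := gchart_trans j i ap ap'; congr Cinf_on; apply/seteqP.
split=> [_ [z [? [? [? ?]]] <-]|_ [e [[We [We' pe]] pe'] <-]].
  by exists (ginv j z); rewrite /= ?ginvK//; split=> //; split=> //; split; rewrite /= ?ginvK.
by exists (gtriv j e) => //; split=> //; split=> //; split=> //; rewrite gtrivK.
Qed.

Lemma smooth_on_ginv i :
  smooth_on (W i `*` setT : set P) (ginv i : P -> glued_manifold).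
Proof.
split=> [z [Wz _]|p _ ap [j [p' [ap' ->]]]]; first exact: ginv_continuous.
have := gchart_trans i j ap ap'; congr Cinf_on; congr image; apply/seteqP.
by split=> [z [? [? [? ?]]]|z [[[? _] ?] [? ?]]].
Qed.

Lemma gmap_local_triv i : local_triv gmap (W i) (gtriv i : glued_manifold -> P).
Proof.
split; [exact: cdom_open|by []|exists (ginv i); split].
- by move=> e We; rewrite gtrivK.
- by move=> z [Wz _]; rewrite ginvK.
- exact: smooth_on_gtriv.
- exact: smooth_on_ginv.
Qed.

Lemma glued_fibre_bundle : fibre_bundle gmap F.
Proof.
split; last first.
  move=> x; have [i Wi] := cdom_cover G x.
  by exists (W i), (gtriv i); split=> //; exact: gmap_local_triv.
have chE := manifold_charted glued_manifold.
apply: smooth_on_local => //; first exact: openT.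
move=> e _; have [i Wi] := cdom_cover G (gmap e).
have oW := open_gproj (cdom_open i).
exists (gmap @^-1` W i); split=> //.
have oC := open_cylinder (cdom_open i).
have sf : smooth_on (W i `*` setT : set P) (fst : P -> M).
  by apply: smooth_on_fst => //; exact: manifold_compatible.
apply: (smooth_on_comp chE chP chM oW oC (smooth_on_gtriv i) _ sf).
by move=> e' We'.
Qed.

End Gluing.

(** * Trivializations of a complex vector bundle *)

Section GeneralLinear.
Variables (R : realType) (r : nat).
Local Notation C := R[i].

Lemma lin1_mxP n (f : 'rV[C]_r -> 'rV[C]_n) w : linear f -> w *m lin1_mx f = f w.
Proof.
move=> lf; pose fM := GRing.isLinear.Build _ _ _ _ _ lf.
by pose fL : {linear _ -> _} := HB.pack f fM; rewrite -[f]/(fL : _ -> _) mul_rV_lin1.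
Qed.

Lemma lin1_mx_mul (F : 'M[C]_r) : lin1_mx (fun w => w *m F) = F.
Proof. by apply/matrixP => i j; rewrite mxE -rowE mxE. Qed.

Lemma mulmx_row_eq n (F F' : 'M[C]_(r, n)) :
  (forall w : 'rV[C]_r, w *m F = w *m F') -> F = F'.
Proof. by move=> FF'; apply/row_matrixP => i; rewrite !rowE. Qed.

Definition GLmul (F F' : GL R r) : GL R r :=
  Sub (val F *m val F') (etrans (unitmx_mul _ _) (introT andP (conj (valP F) (valP F')))).

Definition GLinv (F : GL R r) : GL R r :=
  Sub (invmx (val F)) (etrans (unitmx_inv _) (valP F)).

Lemma GLmulE F F' : val (GLmul F F') = val F *m val F'.
Proof. exact: SubK. Qed.

Lemma GLinvE F : val (GLinv F) = invmx (val F).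
Proof. exact: SubK. Qed.

Lemma GL_conjK X F Y :
  GLmul (GLmul X (GLmul (GLmul (GLinv X) F) Y)) (GLinv Y) = F.
Proof.
apply: val_inj; rewrite !GLmulE !GLinvE; move: (valP X) (valP Y).
move: (val X) (val F) (val Y) => A D E uA uE.
by rewrite !mulmxA mulmxK// mulmxV// mul1mx.
Qed.

Lemma GL_conjKV X F Y :
  GLmul (GLmul (GLinv X) (GLmul (GLmul X F) (GLinv Y))) Y = F.
Proof.
apply: val_inj; rewrite !GLmulE !GLinvE; move: (valP X) (valP Y).
move: (val X) (val F) (val Y) => A D E uA uE.
by rewrite !mulmxA mulmxKV// mulVmx// mul1mx.
Qed.

(** Inversion exchanges source and target frames, as needed for the inverse of a lift. *)
Lemma GLinv_conj X F Y :
  GLinv (GLmul (GLmul (GLinv X) F) Y) = GLmul (GLmul (GLinv Y) (GLinv F)) X.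
Proof.
apply: val_inj; rewrite GLinvE; have := valP (GLmul (GLmul (GLinv X) F) Y).
rewrite !GLmulE !GLinvE; move: (valP X) (valP F) (valP Y).
move: (val X) (val F) (val Y) => A D E uA uD uE uP.
apply: (can_inj (mulKmx uP)); rewrite mulmxV// !mulmxA.
by rewrite mulmxK// mulmxK// mulVmx.
Qed.

End GeneralLinear.

Lemma inj_surj_bijective (S T : Type) (f : S -> T) :
  injective f -> (forall y, exists x, f x = y) -> bijective f.
Proof.
move=> fI /choice[g gK]; exists g => // x; exact: fI.
Qed.

Section VectorBundle.
Variables (R : realType) (V M : manifold R) (p : V -> M) (r : nat).
Variable B : complex_vector_bundle p r.
Local Notation C := R[i].
Local Notation Cr := (Cr_space R r).
Local Notation P := (prod_space M Cr).

(** The trivializations asserted by [vtriv], turned into data with their inverses so that pairs of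
    them can index a cocycle. *)
Record btriv := BTriv {
  bdom : set M;
  btau : V -> P;
  binv : P -> V;
  bdom_open : open bdom;
  btau_fst : forall v, bdom (p v) -> (btau v).1 = p v;
  bdiffeo : diffeo_on (p @^-1` bdom) (bdom `*` setT : set P) btau binv;
  btau_linear : forall y, bdom y ->
    linear (fun a : vfibre B y => (btau (vincl a)).2 : 'rV[C]_r) }.

Lemma btriv_cover x : exists b : btriv, bdom b x.
Proof.
have [U [tau [Ux [oU tau1 [tau' dt]] lt]]] := vtriv B x.
by exists (BTriv oU tau1 dt lt).
Qed.

Implicit Types b : btriv.

Let chM : charted M := manifold_charted M.
Let chV : charted V := manifold_charted V.
Let chC : charted Cr := @Mat_charted R 1 r.
Let chP : charted P := prod_charted chM chC.

Definition tvec b (v : V) : 'rV[C]_r := (btau b v).2.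

Lemma p_vincl x (a : vfibre B x) : p (vincl a) = x.
Proof. by have : (p @^-1` [set x]) (vincl a) by rewrite -(vincl_range B x); exists a. Qed.

Lemma vincl_onto v : exists a : vfibre B (p v), vincl a = v.
Proof.
have : (p @^-1` [set p v]) v by [].
by rewrite -(vincl_range B) => -[a _ av]; exists a.
Qed.

Lemma p_binv b y w : bdom b y -> p (binv b (y, w)) = y.
Proof.
move=> by_; have [_ /(_ (y, w) (conj by_ I))[/= bp tK] _ _] := bdiffeo b.
by rewrite -(btau_fst bp) tK.
Qed.

Lemma tvec_binv b y w : bdom b y -> tvec b (binv b (y, w)) = w.
Proof.
move=> by_; have [_ /(_ (y, w) (conj by_ I))[/= bp tK] _ _] := bdiffeo b.
by rewrite /tvec tK.
Qed.

Lemma tvec_onto b y w : bdom b y -> exists2 v, p v = y & tvec b v = w.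
Proof. by move=> by_; exists (binv b (y, w)); [exact: p_binv|exact: tvec_binv]. Qed.

Lemma btauE b v : bdom b (p v) -> btau b v = (p v, tvec b v).
Proof. by move=> bv; rewrite [LHS]surjective_pairing btau_fst. Qed.

Lemma binv_tvec b v : bdom b (p v) -> binv b (p v, tvec b v) = v.
Proof.
by move=> bv; have [/(_ v bv)[_ vK] _ _ _] := bdiffeo b; rewrite -btauE.
Qed.

(** Inverse of the fibre coordinate with values in the abstract space [vfibre B y], where linearity
    can be stated. Over [bdom b] the default 0 is never taken for lack of a preimage. *)
Definition frame b y (w : 'rV[C]_r) : vfibre B y :=
  xget 0 [set a | vincl a = binv b (y, w)].

Lemma vincl_frame b y w : bdom b y -> vincl (frame b y w) = binv b (y, w).
Proof.
move=> by_; rewrite /frame; case: xgetP => // nex.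
have := vincl_onto (binv b (y, w)); rewrite p_binv // => -[a ae].
by have := nex a; rewrite /= ae.
Qed.

Lemma tvec_frame b y w : bdom b y -> tvec b (vincl (frame b y w)) = w.
Proof. by move=> by_; rewrite vincl_frame// tvec_binv. Qed.

Lemma frame_tvec b y (a : vfibre B y) : bdom b y -> frame b y (tvec b (vincl a)) = a.
Proof.
move=> by_; apply: (@vincl_inj _ _ _ _ _ B); rewrite vincl_frame//.
by rewrite -{1}(p_vincl a) binv_tvec // p_vincl.
Qed.

Lemma tvec_linear b y : bdom b y -> linear (fun a : vfibre B y => tvec b (vincl a)).
Proof. exact: btau_linear. Qed.

Lemma frame_linear b y : bdom b y -> linear (frame b y).
Proof.
move=> by_ k u v; rewrite -[RHS](frame_tvec _ by_); congr frame.
by rewrite (tvec_linear by_) !tvec_frame.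
Qed.

(** Matrices act on row vectors from the right, so changes of trivialization compose from left to
    right. *)
Definition trans b b' (y : M) : 'M[C]_r := lin1_mx (fun w => tvec b' (binv b (y, w))).

Lemma tvec_trans b b' v : bdom b (p v) -> bdom b' (p v) ->
  tvec b v *m trans b b' (p v) = tvec b' v.
Proof.
move=> bv b'v; rewrite lin1_mxP ?binv_tvec// => k u w.
by rewrite -!vincl_frame// (frame_linear bv) (tvec_linear b'v).
Qed.

Lemma transM b b' b'' y : bdom b y -> bdom b' y -> bdom b'' y ->
  trans b b' y *m trans b' b'' y = trans b b'' y.
Proof.
move=> by_ b'y b''y; apply: mulmx_row_eq => w; rewrite mulmxA.
have [v pv <-] := tvec_onto w by_; subst y.
by rewrite !tvec_trans.
Qed.

Lemma trans1 b y : bdom b y -> trans b b y = 1%:M.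
Proof.
move=> by_; apply: mulmx_row_eq => w.
have [v pv <-] := tvec_onto w by_; subst y.
by rewrite tvec_trans// mulmx1.
Qed.

Lemma trans_unit b b' y : bdom b y -> bdom b' y -> trans b b' y \in unitmx.
Proof.
move=> by_ b'y; have : trans b b' y *m trans b' b y = 1%:M by rewrite transM // trans1.
by case/mulmx1_unit.
Qed.

Lemma invmx_trans b b' y : bdom b y -> bdom b' y -> invmx (trans b b' y) = trans b' b y.
Proof.
move=> by_ b'y; apply: (can_inj (mulKmx (trans_unit by_ b'y))).
by rewrite mulmxV ?trans_unit// transM// trans1.
Qed.

Lemma open_bdomT b : open (bdom b `*` setT : set P).
Proof. exact: open_setX (bdom_open b) openT. Qed.

Lemma p_continuous : continuous p.
Proof. by move=> v; have [+ _] := vproj_smooth B; apply. Qed.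

Lemma open_p (A : set M) : open A -> open (p @^-1` A).
Proof. by move=> oA; apply: open_comp => // v _; exact: p_continuous. Qed.

Lemma smooth_on_p (A : set V) : open A -> smooth_on A p.
Proof. by move=> oA; apply: (smooth_on_sub chV chM openT oA) (vproj_smooth B). Qed.

Lemma smooth_on_tvec b : smooth_on (p @^-1` bdom b) (tvec b : V -> Cr).
Proof.
have [tt _ st _] := bdiffeo b.
have s2 : smooth_on (bdom b `*` setT : set P) (snd : P -> Cr).
  exact: (smooth_on_snd chM chC (@Mat_compatible R 1 r) (@open_bdomT b)).
apply: (smooth_on_comp chV chP chC (open_p (bdom_open b)) (@open_bdomT b) st _ s2).
by move=> v /tt[].
Qed.

(** The i-th row is f(y, e_i), and y |-> (y, e_i) is smooth. *)
Lemma mxsmooth_rows (A : set M) (f : P -> Cr) : open A ->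
  smooth_on (A `*` setT : set P) f ->
  mxsmooth A (fun y => lin1_mx (fun w : 'rV[C]_r => f (y, w) : 'rV[C]_r)).
Proof.
move=> oA sf i j.
have oAT : open (A `*` setT : set P) by exact: open_setX oA openT.
have sy : smooth_on A ((fun y => (y, delta_mx 0 i : 'rV[C]_r)) : M -> P).
  apply: smooth_on_pair => //; last exact: smooth_on_cst.
  by apply: smooth_on_id => //; exact: manifold_compatible.
have sfy := smooth_on_comp chM chP chC oA oAT sy (fun y Ay => conj Ay I) sf.
have /(_ 0 j) := iffLR (@smooth_on_Mat R M A 1 r _ chM oA) sfy.
by apply: csmooth_ext => // y _; rewrite mxE.
Qed.

Lemma smooth_on_mulmx (X : space_with_charts R) (A : set X) (f : X -> Cr)
  (F : X -> 'M[C]_r) : charted X -> open A -> smooth_on A f -> mxsmooth A F ->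
  smooth_on A ((fun x => (f x : 'rV[C]_r) *m F x) : X -> Cr).
Proof.
move=> chX oA sf sF; apply/(@smooth_on_Mat R X A 1 r) => //; apply: mxsmooth_mul => //.
exact/(@smooth_on_Mat R X A 1 r).
Qed.

Lemma mxsmooth_trans b b' : mxsmooth (bdom b `&` bdom b') (trans b b').
Proof.
have oA : open (bdom b `&` bdom b') by apply: openI; exact: bdom_open.
have oAT : open ((bdom b `&` bdom b') `*` setT : set P) by exact: open_setX oA openT.
apply: (@mxsmooth_rows _ (fun z => tvec b' (binv b z))) => //.
have [_ bK _ sb] := bdiffeo b.
have sb' : smooth_on ((bdom b `&` bdom b') `*` setT : set P) (binv b).
  by apply: (smooth_on_sub chP chV (@open_bdomT b)) sb => // z [[bz _] _].
apply: (smooth_on_comp chP chV chC oAT (open_p (bdom_open b')) sb' _ (@smooth_on_tvec b')).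
by move=> [y w] [[by_ b'y] _] /=; rewrite p_binv.
Qed.

End VectorBundle.

(** * Lifts of a map to fibrewise linear maps *)

Section LiftBundle.
Variables (R : realType) (V M : manifold R) (p : V -> M) (r : nat).
Variable B : complex_vector_bundle p r.
Local Notation C := R[i].
Local Notation Cr := (Cr_space R r).
Local Notation P := (prod_space M Cr).
Local Notation GLs := (GL_space R r).
Local Notation btriv := (btriv B).

Variable beta : M -> btriv.
Hypothesis betaP : forall x, bdom (beta x) x.

Let chM : charted M := manifold_charted M.
Let chV : charted V := manifold_charted V.
Let chC : charted Cr := @Mat_charted R 1 r.
Let chP : charted P := prod_charted chM chC.
Let chG : charted GLs := @GL_charted R r.
Let chQ : charted (prod_space M GLs) := prod_charted chM chG.

(** The change of frame H of the overview. The default keeps it invertible at every [x], because a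
    [cocycle] must consist of bijections over all of M, also outside [cdom i]. *)
Definition framing (b : btriv) (x : M) : GL R r :=
  insubd (GL_one R r) (trans (beta x) b x).

Lemma framingE b x : bdom b x -> val (framing b x) = trans (beta x) b x.
Proof. by move=> bx; rewrite val_insubd trans_unit. Qed.

(* A matrix [F] stands for the isomorphism from V_x to V_(alpha x) that it
   represents in the trivializations chosen at [x] and [alpha x]; [local_mx]
   is its expression in the trivializations [i.1] and [i.2]. *)
Definition lift_dom (alpha : M -> M) (i : btriv * btriv) : set M :=
  bdom i.1 `&` alpha @^-1` bdom i.2.

Definition local_mx (alpha : M -> M) (i : btriv * btriv) (x : M) (F : GL R r) : GL R r :=
  GLmul (GLmul (GLinv (framing i.1 x)) F) (framing i.2 (alpha x)).

Definition global_mx (alpha : M -> M) (i : btriv * btriv) (x : M) (F : GL R r) : GL R r :=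
  GLmul (GLmul (framing i.1 x) F) (GLinv (framing i.2 (alpha x))).

Lemma local_mxK alpha i x : cancel (local_mx alpha i x) (global_mx alpha i x).
Proof. by move=> F; exact: GL_conjK. Qed.

Lemma global_mxK alpha i x : cancel (global_mx alpha i x) (local_mx alpha i x).
Proof. by move=> F; exact: GL_conjKV. Qed.

Lemma local_mxE alpha i x F : lift_dom alpha i x ->
  val (local_mx alpha i x F) =
    trans i.1 (beta x) x *m val F *m trans (beta (alpha x)) i.2 (alpha x).
Proof.
move=> [i1 i2]; rewrite !GLmulE GLinvE !framingE//.
by rewrite invmx_trans.
Qed.

Lemma local_global_mxE alpha i j x F : lift_dom alpha i x -> lift_dom alpha j x ->
  val (local_mx alpha j x (global_mx alpha i x F)) =
    trans j.1 i.1 x *m val F *m trans i.2 j.2 (alpha x).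
Proof.
move=> [i1 i2] jx; rewrite local_mxE//; case: jx => j1 j2.
rewrite !GLmulE GLinvE !framingE// invmx_trans//.
by rewrite -!mulmxA transM// mulmxA transM// mulmxA.
Qed.

Section Along.
Variable alpha : M -> M.
Hypothesis alpha_smooth : smooth alpha.

Lemma alpha_continuous : continuous alpha.
Proof. by move=> x; have [+ _] := alpha_smooth; apply. Qed.

Lemma open_lift_dom i : open (lift_dom alpha i).
Proof.
apply: openI; first exact: bdom_open.
by apply: open_comp (bdom_open _) => x _; exact: alpha_continuous.
Qed.

Lemma lift_dom_cover x : exists i, lift_dom alpha i x.
Proof. by exists (beta x, beta (alpha x)); split; exact: betaP. Qed.

Lemma smooth_on_alpha (A : set M) : open A -> smooth_on A alpha.
Proof. by move=> oA; apply: smooth_on_sub alpha_smooth => //; exact: openT. Qed.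

Lemma local_global_smooth i j :
  smooth_on ((lift_dom alpha i `&` lift_dom alpha j) `*` setT : set (prod_space M GLs))
    ((fun z => (z.1, local_mx alpha j z.1 (global_mx alpha i z.1 z.2)))
      : prod_space M GLs -> prod_space M GLs).
Proof.
set A := lift_dom alpha i `&` lift_dom alpha j.
have oA : open A by apply: openI; exact: open_lift_dom.
have oAT : open (A `*` setT : set (prod_space M GLs)) by exact: open_setX oA openT.
have s1 : smooth_on (A `*` setT : set (prod_space M GLs)) (fst : prod_space M GLs -> M).
  by apply: smooth_on_fst => //; exact: manifold_compatible.
have s2 : smooth_on (A `*` setT : set (prod_space M GLs)) (snd : prod_space M GLs -> GLs).
  by apply: smooth_on_snd => //; exact: GL_compatible.
apply: smooth_on_pair => //; apply/smooth_on_GL => //.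
apply: (@mxsmooth_ext _ _ _ chQ oAT _ _ (fun z =>
  trans j.1 i.1 z.1 *m val (z.2 : GL R r) *m trans i.2 j.2 (alpha z.1))).
  by move=> z [[zi zj] _]; rewrite local_global_mxE.
have sA : smooth_on A alpha by exact: smooth_on_alpha.
apply: mxsmooth_mul => //; first apply: mxsmooth_mul => //.
- have oB : open (bdom j.1 `&` bdom i.1) by apply: openI; exact: bdom_open.
  apply: (mxsmooth_comp chQ chM oAT oB s1 _ (mxsmooth_trans j.1 i.1)).
  by move=> z [[[? _] [? _]] _].
- exact: (mxsmooth_comp chQ chG oAT openT s2 _ (mxsmooth_val openT)).
- have oB : open (bdom i.2 `&` bdom j.2) by apply: openI; exact: bdom_open.
  have st := mxsmooth_comp chM chM oA oB sA _ (mxsmooth_trans i.2 j.2).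
  apply: (mxsmooth_comp chQ chM oAT oA s1 _ (st _)) => [z []//|z [[_ ?] [_ ?]]//].
Qed.

Definition lift_cocycle : cocycle M GLs :=
  @Cocycle R M GLs (btriv * btriv)%type (lift_dom alpha) (local_mx alpha)
    (global_mx alpha) open_lift_dom lift_dom_cover (local_mxK alpha)
    (global_mxK alpha) local_global_smooth.

(** [F] is read in frames that may jump, so its smoothness is tested on the local expressions; this
    condition is the common ground of sections and lifts. *)
Definition mx_smooth (F : M -> GL R r) : Prop :=
  forall i, mxsmooth (lift_dom alpha i) (fun x => val (local_mx alpha i x (F x))).

Definition lift (F : M -> GL R r) (v : V) : V :=
  let x := p v in
  binv (beta (alpha x)) (alpha x, tvec (beta x) v *m val (F x)).

Lemma p_lift F v : p (lift F v) = alpha (p v).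
Proof. by rewrite p_binv. Qed.

(** Frees [lift] from the chosen frames: over [lift_dom alpha i] it is a formula in two fixed
    trivializations, visibly smooth. *)
Lemma lift_localE F i v : lift_dom alpha i (p v) ->
  lift F v = binv i.2 (alpha (p v), tvec i.1 v *m val (local_mx alpha i (p v) (F (p v)))).
Proof.
move=> ix; have [i1 i2] := ix; have pl := p_lift F v.
rewrite local_mxE// !mulmxA tvec_trans// -[in LHS](@binv_tvec _ _ _ _ _ B i.2 (lift F v)) ?pl//.
congr (binv _ (_, _)); rewrite -(@tvec_trans _ _ _ _ _ B (beta (alpha (p v)))) ?pl//.
by rewrite tvec_binv.
Qed.

Lemma lift_vincl F x (a : vfibre B x) :
  lift F (vincl a) =
  vincl (frame (beta (alpha x)) (alpha x) (tvec (beta x) (vincl a) *m val (F x))).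
Proof. by rewrite vincl_frame// /lift p_vincl. Qed.

Lemma smooth_lift F : mx_smooth F -> smooth (lift F).
Proof.
move=> sF; apply: smooth_on_local => // [|v _]; first exact: openT.
have [i ix] := lift_dom_cover (p v).
have oW := open_lift_dom i; have oA := open_p B oW.
exists (p @^-1` lift_dom alpha i); split=> //.
apply: (@smooth_on_ext _ _ _ _ (fun v : V => binv i.2 (alpha (p v),
  tvec i.1 v *m val (local_mx alpha i (p v) (F (p v)))))) => //.
  by move=> u iu; rewrite (lift_localE _ iu).
have sp := smooth_on_p B oA.
have spa := smooth_on_comp chV chM chM oA oW sp (fun _ => id) (smooth_on_alpha oW).
have st : smooth_on (p @^-1` lift_dom alpha i) (tvec i.1 : V -> Cr).
  apply: (smooth_on_sub chV chC (open_p B (bdom_open i.1)) oA _ (@smooth_on_tvec _ _ _ _ _ B i.1)).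
  by move=> u [].
have sl := mxsmooth_comp chV chM oA oW sp (fun _ => id) (sF i).
have sm := smooth_on_mulmx chV oA st sl.
have [_ _ _ sb] := bdiffeo i.2.
apply: (smooth_on_comp chV chP chV oA (@open_bdomT _ _ _ _ _ B i.2)
  (smooth_on_pair chM chC chV oA spa sm) _ sb).
by move=> u [].
Qed.

(** * The matrix field of a given fibrewise linear map *)

Definition mx_of_map (b b' : btriv) (Phi : V -> V) (x : M) : 'M[C]_r :=
  lin1_mx (fun w => tvec b' (Phi (binv b (x, w)))).

Lemma mx_of_lift F x : mx_of_map (beta x) (beta (alpha x)) (lift F) x = val (F x).
Proof.
rewrite -[RHS]lin1_mx_mul; congr lin1_mx; apply/funext => w.
by rewrite /lift p_binv// !tvec_binv.
Qed.

Lemma lift_inj : injective lift.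
Proof.
move=> F F' FF'; apply/funext => x; apply: val_inj.
by rewrite -!mx_of_lift FF'.
Qed.

Section MatrixOfMap.
Variable Phi : V -> V.
Hypotheses (PhiA : lifts p alpha Phi) (Phi_inj : injective Phi) (Phi_smooth : smooth Phi).
Hypothesis Phi_linear : forall x, exists2 f : vfibre B x -> vfibre B (alpha x),
  linear f & forall a, Phi (vincl a) = vincl (f a).

Lemma tvec_map b b' v : bdom b (p v) -> bdom b' (alpha (p v)) ->
  tvec b v *m mx_of_map b b' Phi (p v) = tvec b' (Phi v).
Proof.
move=> bv b'v; rewrite lin1_mxP ?binv_tvec// => k u w.
have [f lf fP] := Phi_linear (p v).
by rewrite -!vincl_frame// !fP (frame_linear bv) lf (tvec_linear b'v).
Qed.

(** A vector in the kernel has the same image under [Phi] as the zero vector [u] of its fibre, hence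
    equals it; a square matrix with trivial kernel is invertible. *)
Lemma mx_of_map_unit b b' x : bdom b x -> bdom b' (alpha x) ->
  mx_of_map b b' Phi x \in unitmx.
Proof.
move=> bx b'x; rewrite -row_free_unit; apply: inj_row_free => w.
have [v pv <-] := tvec_onto w bx; subst x; rewrite tvec_map// => v0.
have [u pu u0] := tvec_onto (0 : 'rV[C]_r) bx.
suff -> : v = u by [].
apply: Phi_inj; rewrite -(@binv_tvec _ _ _ _ _ B b' (Phi v)) ?PhiA//.
rewrite -(@binv_tvec _ _ _ _ _ B b' (Phi u)) ?PhiA pu//; congr (binv _ (_, _)).
rewrite v0; apply/esym.
by rewrite -(@tvec_map b b' u) ?pu// u0 mul0mx.
Qed.

Definition coef (x : M) : GL R r :=
  insubd (GL_one R r) (mx_of_map (beta x) (beta (alpha x)) Phi x).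

Lemma coefE x : val (coef x) = mx_of_map (beta x) (beta (alpha x)) Phi x.
Proof. by rewrite val_insubd mx_of_map_unit. Qed.

Lemma lift_coef : lift coef = Phi.
Proof.
apply/funext => v; rewrite /lift coefE tvec_map// -PhiA binv_tvec//.
Qed.

Lemma local_coef i x : lift_dom alpha i x ->
  val (local_mx alpha i x (coef x)) = mx_of_map i.1 i.2 Phi x.
Proof.
move=> ix; rewrite local_mxE// coefE; have [i1 i2] := ix.
apply: mulmx_row_eq => w; have [v pv <-] := tvec_onto w i1; subst x.
rewrite tvec_map// !mulmxA tvec_trans// tvec_map//.
by rewrite -PhiA tvec_trans// PhiA.
Qed.

(** By [local_coef] the chosen frames drop out: what remains is the matrix of the smooth map [Phi]
    in two fixed trivializations. *)
Lemma mx_smooth_coef : mx_smooth coef.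
Proof.
move=> i; have oW := open_lift_dom i.
apply: (mxsmooth_ext chM oW (fun x ix => esym (local_coef ix))).
have oWT : open (lift_dom alpha i `*` setT : set P) by exact: open_setX oW openT.
apply: (@mxsmooth_rows R M r _ (fun z => tvec i.2 (Phi (binv i.1 z)))) => //.
have [_ bK _ sb] := bdiffeo i.1.
have sb' : smooth_on (lift_dom alpha i `*` setT : set P) (binv i.1).
  by apply: (smooth_on_sub chP chV (@open_bdomT _ _ _ _ _ B i.1)) sb => // z [[bz _] _].
have sPb := smooth_on_comp chP chV chV oWT openT sb' (fun _ _ => I) Phi_smooth.
apply: (smooth_on_comp chP chV chC oWT (open_p B (bdom_open i.2)) sPb _
  (@smooth_on_tvec _ _ _ _ _ B i.2)).
by move=> [y w] [[i1 i2] _] /=; rewrite PhiA p_binv.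
Qed.

End MatrixOfMap.

End Along.

End LiftBundle.

(** * Sections and linear lifts *)

Section Sections.
Variables (R : realType) (V M : manifold R) (p : V -> M) (r : nat).
Variable B : complex_vector_bundle p r.
Local Notation GLs := (GL_space R r).
Local Notation Q := (prod_space M GLs).

Variable beta : M -> btriv B.
Hypothesis betaP : forall x, bdom (beta x) x.
Variables (phi psi : M -> M).
Hypotheses (phi_smooth : smooth phi) (psi_smooth : smooth psi).
Hypotheses (phiK : cancel phi psi) (psiK : cancel psi phi).

Let chM : charted M := manifold_charted M.
Let chG : charted GLs := @GL_charted R r.
Let chQ : charted Q := prod_charted chM chG.

Definition lift_bundle : manifold R :=
  @glued_manifold R M GLs (lift_cocycle betaP phi_smooth) chG (@GL_hausdorff R r)
    (@GL_second_countable R r) (@GL_connected R r) (GL_one R r).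
Local Notation E := lift_bundle.

Definition lift_proj : E -> M :=
  @gmap _ _ _ (lift_cocycle betaP phi_smooth) chG (@GL_hausdorff R r)
    (@GL_second_countable R r) (@GL_connected R r) (GL_one R r).
Local Notation q := lift_proj.

Let chE : charted E := manifold_charted E.

(** The underlying set of [E] is convertible to [M * GL R r], the second component being the matrix
    in the chosen frames. *)
Definition section_field (s : global_section q) (x : M) : GL R r := (s x : M * GL R r).2.

Lemma section_fieldE (s : global_section q) x : s x = ((x, section_field s x) : M * GL R r).
Proof. by apply: injective_projections; [exact: (sectionP s x)|]. Qed.

Lemma mx_smooth_section (s : global_section q) :
  mx_smooth beta phi (section_field s).
Proof.
move=> i; pose W := lift_dom phi i.
have oW : open W by exact: open_lift_dom.
have oWT : open (W `*` setT : set Q) by exact: open_setX oW openT.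
have ss : smooth_on W s.
  by apply: (smooth_on_sub chM chE openT oW) (section_smooth s).
have st := @smooth_on_gtriv R M GLs (lift_cocycle betaP phi_smooth) chG (@GL_hausdorff R r)
    (@GL_second_countable R r) (@GL_connected R r) (GL_one R r) i.
have oqW : open (q @^-1` W) by exact: (@open_gproj _ _ _ (lift_cocycle betaP phi_smooth)).
have sts := smooth_on_comp chM chE chQ oW oqW ss _ st.
have {}sts := sts (fun x Wx => eq_ind_r W Wx (sectionP s x)).
have s2 : smooth_on (W `*` setT : set Q) (snd : Q -> GLs).
  by apply: smooth_on_snd => //; exact: GL_compatible.
have /(smooth_on_GL _ chM oW) := smooth_on_comp chM chQ chG oW oWT sts
  (fun x Wx => conj (eq_ind_r W Wx (sectionP s x)) I) s2.
apply: (mxsmooth_ext chM oW) => x _.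
by rewrite section_fieldE.
Qed.

Lemma smooth_field_section (F : M -> GL R r) : mx_smooth beta phi F ->
  smooth ((fun x => (x, F x)) : M -> E).
Proof.
move=> sF; apply: smooth_on_local => // [|x _]; first exact: openT.
have [i ix] := lift_dom_cover betaP phi x; pose W := lift_dom phi i.
have oW : open W by exact: open_lift_dom.
have oWT : open (W `*` setT : set Q) by exact: open_setX oW openT.
exists W; split=> //.
have sg := @smooth_on_ginv R M GLs (lift_cocycle betaP phi_smooth) chG (@GL_hausdorff R r)
    (@GL_second_countable R r) (@GL_connected R r) (GL_one R r) i.
have sid := smooth_on_id chM (@manifold_compatible R M) oW.
have sl := iffRL (smooth_on_GL (fun x => local_mx beta phi i x (F x)) chM oW) (sF i).
have sp := smooth_on_pair chM chG chM oW sid sl.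
have := smooth_on_comp chM chQ chE oW oWT sp (fun x Wx => conj Wx I) sg.
apply: smooth_on_ext => // y _.
by rewrite /ginv /= local_mxK.
Qed.

Definition field_section F (sF : mx_smooth beta phi F) : global_section q :=
  @GlobalSection R E M q (fun x => (x, F x)) (smooth_field_section sF) (fun x => erefl).

Lemma global_section_inj (s s' : global_section q) : section_field s = section_field s' -> s = s'.
Proof.
move=> ss'; have: s = s' :> (M -> E).
  by apply/funext => x; rewrite !section_fieldE ss'.
case: s s' {ss'} => [f fs fq] [g gs gq] /= fg; subst g.
by congr GlobalSection; exact: Prop_irrelevance.
Qed.

Lemma smooth_inverse_field F : mx_smooth beta phi F ->
  mx_smooth beta psi (fun y => GLinv (F (psi y))).
Proof.
(* Over y the inverse goes from the fibre at y to that at [psi y], so the source trivialization of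
   one map is the target trivialization of the other. *)
move=> sF i; pose j := (i.2, i.1); pose W := lift_dom psi i.
have oW : open W by exact: open_lift_dom.
have oj : open (lift_dom phi j) by exact: open_lift_dom.
have Wj y : W y -> lift_dom phi j (psi y) by move=> [i1 i2]; split=> //=; rewrite psiK.
have sj := mxsmooth_comp chM chM oW oj (smooth_on_alpha psi_smooth oW) Wj (sF j).
have := mxsmooth_inv chM oW (fun x _ => valP (local_mx beta phi j (psi x) (F (psi x)))) sj.
apply: mxsmooth_ext => // y Wy.
by rewrite -GLinvE /local_mx psiK GLinv_conj.
Qed.

Lemma lift_inverseK F : cancel (lift beta phi F) (lift beta psi (fun y => GLinv (F (psi y)))).
Proof.
move=> v; rewrite {1}/lift p_lift//.
rewrite /lift tvec_binv// GLinvE phiK mulmxK; last exact: valP.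
exact: binv_tvec.
Qed.

Lemma lift_inverseKV F : cancel (lift beta psi (fun y => GLinv (F (psi y)))) (lift beta phi F).
Proof.
move=> v; rewrite {1}/lift p_lift//.
rewrite /lift tvec_binv// GLinvE psiK mulmxKV; last exact: valP.
exact: binv_tvec.
Qed.

Lemma lift_automorphism F : mx_smooth beta phi F ->
  Clinear_automorphism B (lift beta phi F) /\ lifts p phi (lift beta phi F).
Proof.
move=> sF; have pl := p_lift betaP phi F; split=> //; split.
  exists (lift beta psi (fun y => GLinv (F (psi y)))); split.
  - by move=> v _; split=> //; exact: lift_inverseK.
  - by move=> v _; split=> //; exact: lift_inverseKV.
  - exact: smooth_lift.
  - exact/smooth_lift/smooth_inverse_field.
move=> x; exists (phi x); split.
  apply/seteqP; split=> [_ [v <- <-]|v pv]; first exact: pl.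
  exists (lift beta psi (fun y => GLinv (F (psi y))) v); last exact: lift_inverseKV.
  by rewrite /= p_lift// pv phiK.
exists (fun a => frame (beta (phi x)) (phi x) (tvec (beta x) (vincl a) *m val (F x))).
  move=> k u w; rewrite (tvec_linear (betaP x)) mulmxDl -scalemxAl.
  exact: frame_linear.
by move=> a; rewrite lift_vincl.
Qed.

(** A [bundle_automorphism] only provides some target [x']; following the vector sent to [f 0]
    through [p] shows that it is [phi x]. *)
Lemma automorphism_linear Phi : Clinear_automorphism B Phi -> lifts p phi Phi ->
  forall x, exists2 f : vfibre B x -> vfibre B (phi x),
    linear f & forall a, Phi (vincl a) = vincl (f a).
Proof.
move=> [_ Phil] Phip x; have [x' [_ [f lf fP]]] := Phil x.
have xx' : x' = phi x by rewrite -(p_vincl (f 0)) -fP Phip p_vincl.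
by subst x'; exists f.
Qed.

Lemma automorphism_inj Phi : Clinear_automorphism B Phi -> injective Phi.
Proof. by move=> [[g [gK _ _ _]] _]; apply: (can_inj (g := g)) => v; have [_] := gK v I. Qed.

Lemma automorphism_smooth Phi : Clinear_automorphism B Phi -> smooth Phi.
Proof. by move=> [[g [_ _ + _]] _]. Qed.

Definition section_lift (s : global_section q) : Clinear_lift B phi :=
  exist _ (lift beta phi (section_field s)) (lift_automorphism (mx_smooth_section s)).

Lemma section_lift_bijective : bijective section_lift.
Proof.
apply: inj_surj_bijective => [s s' /(congr1 sval)/= ss'|[Phi [aPhi pPhi]]].
  exact/global_section_inj/(lift_inj betaP ss').
have lPhi := automorphism_linear aPhi pPhi; have iPhi := automorphism_inj aPhi.
have sF := mx_smooth_coef betaP phi_smooth pPhi iPhi (automorphism_smooth aPhi) lPhi.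
exists (field_section sF); apply: eq_exist => /=.
exact: lift_coef.
Qed.

Definition field_iso x (F : GL R r) (a : vfibre B x) : vfibre B (phi x) :=
  frame (beta (phi x)) (phi x) (tvec (beta x) (vincl a) *m val F).

Lemma field_isoP x F : Clinear (@field_iso x F) /\ bijective (@field_iso x F).
Proof.
split.
  move=> k u w; rewrite /field_iso (tvec_linear (betaP x)) mulmxDl -scalemxAl.
  exact: frame_linear.
exists (fun a => frame (beta x) x (tvec (beta (phi x)) (vincl a) *m invmx (val F))) => a.
  by rewrite /field_iso tvec_frame// mulmxK ?frame_tvec//; exact: valP.
by rewrite /field_iso tvec_frame// mulmxKV ?frame_tvec//; exact: valP.
Qed.

Definition fibre_iso x (e : fibre q x) : Ciso (vfibre B x) (vfibre B (phi x)) :=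
  exist _ (field_iso (sval e : M * GL R r).2) (field_isoP x _).

Lemma fibre_iso_bijective x : bijective (@fibre_iso x).
Proof.
apply: inj_surj_bijective => [[[y F] /= qe] [[y' F'] /= qe'] /(congr1 sval)/= FF'|[f [lf bf]]].
  have [yx y'x] : y = x /\ y' = x by [].
  apply: eq_exist; rewrite yx y'x; congr pair.
  apply: val_inj; apply: mulmx_row_eq => w.
  have := congr1 (fun g => tvec (beta (phi x)) (vincl (g (frame (beta x) x w)))) FF'.
  by rewrite /= /field_iso !tvec_frame.
(* Surjectivity: [g] is the isomorphism [f] in the chosen frames. Its matrix is invertible because
   [f] is injective, and gives the required point of the fibre. *)
pose g w := tvec (beta (phi x)) (vincl (f (frame (beta x) x w))).
have lg : linear g.
  by move=> k u w; rewrite /g (frame_linear (betaP x)) lf (tvec_linear (betaP _)).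
have ug : lin1_mx g \in unitmx.
  rewrite -row_free_unit; apply: inj_row_free => w; rewrite lin1_mxP// => g0.
  have f0 : frame (beta x) x w = frame (beta x) x 0.
    apply: (bij_inj bf); rewrite -[LHS](frame_tvec _ (betaP _)) -[RHS](frame_tvec _ (betaP _)).
    congr frame; rewrite -/(g w) g0 -/(g 0).
    (* Linearity with scalar -1 yields g 0 = - g 0 + g 0 = 0. *)
    by have := lg (-1) 0 0; rewrite scaler0 addr0 scaleN1r addNr.
  by rewrite -(tvec_frame w (betaP x)) f0 tvec_frame.
exists (exist (fun e : E => q e = x) (x, Sub (lin1_mx g) ug) erefl); apply: eq_exist => /=.
apply/funext => a; rewrite /field_iso SubK lin1_mxP// /g.
by rewrite !frame_tvec.
Qed.

Lemma lift_sections_identified : sections_identified B phi q.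
Proof.
exists fibre_iso, section_lift; split.
- exact: fibre_iso_bijective.
- exact: section_lift_bijective.
- by move=> s x a /=; rewrite lift_vincl.
Qed.

Lemma lift_fibre_bundle : fibre_bundle q GLs.
Proof. exact: glued_fibre_bundle. Qed.

End Sections.

Theorem proposition17 (R : realType) (V M : manifold R) (p : V -> M) (r : nat)
    (B : complex_vector_bundle p r) (phi : M -> M) :
  diffeomorphism phi ->
  (exists Phi : V -> V, Rlinear_automorphism B Phi /\ lifts p phi Phi) ->
  exists (E : manifold R) (q : E -> M),
    fibre_bundle q (GL_space R r) /\ sections_identified B phi q.
Proof.
move=> [psi [phiK psiK phi_smooth psi_smooth]] _.
have /choice[beta betaP] := btriv_cover B.
exists (lift_bundle betaP phi_smooth), (@lift_proj R V M p r B beta betaP phi phi_smooth).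
split; first exact: lift_fibre_bundle.
by apply: (lift_sections_identified betaP phi_smooth psi_smooth) => x;
  [have [] := phiK x I|have [] := psiK x I].
Qed.
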